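(* Let $p\colon\mathbb{E}\to\mathbb{B}$ be a locally small bifibration that satisfies the Beck-Chevalley condition and has fibred pushouts, where $\mathbb{B}$ has all finite limits. Then for every vertical map $m$ of $\mathbb{E}$, step-one of the small object argument on $m$, $(L_1,R_1)$, is a fibred lawfs.
   Context: Fibrations. $p$ is cloven, with reindexing $\sigma^*$; it is a bifibration if $p$ and $p^{op}$ are both fibrations. Vertical maps are maps sent by $p$ to identities; $\mathbb{E}_I$ is the fibre over $I$. $V(\mathbb{E})$ is the full subcategory of $\mathbb{E}^{\mathbf 2}$ on vertical maps; it is fibred over $\mathbb{B}$ by $p\circ\mathrm{dom}=p\circ\mathrm{cod}$, with levelwise reindexing. $p$ is locally small if for all $X,Y\in\mathbb{E}_I$ the functor $(u\colon J\to I)\mapsto\mathbb{E}_J(u^*X,u^*Y)$ on $(\mathbb{B}/I)^{op}$ is representable. $p$ has fibred pushouts if each fibre has pushouts and they are preserved by reindexing. Beck-Chevalley condition (for $p$): given a commutative square in $\mathbb{E}$ with $f\colon X\to Y$ on the left, $h\colon X\to V$ on top, $g\colon V\to W$ on the right and $k\colon Y\to W$ on the bottom, if its image in $\mathbb{B}$ is a pullback, $g$ is cartesian and $k$ is opcartesian, then $h$ is opcartesian if and only if $f$ is cartesian. Lawfs. A functorial factorisation over $\mathbb{B}$ functorially factors each vertical $f\colon X\to Y$ as $X\xrightarrow{Lf}Kf\xrightarrow{Rf}Y$ with both maps vertical (over $\mathbb{B}$). An lawfs is a functorial factorisation with a comultiplication making $L$, with counit $(1_X,Rf)\colon Lf\to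 f$, a comonad over $\mathrm{dom}\colon V(\mathbb{E})\to\mathbb{E}$. It is fibred if the functor $f\mapsto(Lf,Rf)$ preserves cartesian maps over $\mathbb{B}$; equivalently $L\colon V(\mathbb{E})\to V(\mathbb{E})$ preserves cartesian maps over $p\circ\mathrm{dom}$. Step-one. Let $m$ be vertical over $I$. For a vertical $f$ over $J$ let $(\underline{\mathrm{Hom}}(m,f),\sigma_f\colon\underline{\mathrm{Hom}}(m,f)\to I,\tau_f\colon\underline{\mathrm{Hom}}(m,f)\to J,h_f\colon\sigma_f^*(m)\to f)$, with $h_f$ in $V(\mathbb{E})$ over $\tau_f$, be the universal lifting problem from $m$ to $f$: any $(K,\sigma,\tau,h\colon\sigma^*(m)\to f\text{ over }\tau)$ is $(\sigma_ft,\tau_ft,h_f\circ c)$ for a unique $t\colon K\to\underline{\mathrm{Hom}}(m,f)$, $c\colon\sigma^*(m)\to\sigma_f^*(m)$ the canonical cartesian map over $t$. (It exists by local smallness and finite limits in $\mathbb{B}$.) Under the hypotheses $\mathrm{dom}\colon V(\mathbb{E})\to\mathbb{E}$ is an opfibration; factor $h_f=\epsilon_f\circ k_f$ with $k_f\colon\sigma_f^*(m)\to L_1f$ opcartesian over $\mathrm{dom}$ and $\epsilon_f\colon L_1f\to f$ having identity domain component. Then $R_1f$ is the codomain component of $\epsilon_f$, and $\epsilon$ is the counit. The comultiplication $\Sigma_f\colon L_1f\to L_1L_1f$ is the unique map with identity domain component such that $\Sigma_f\circ k_f=k_{L_1f}\circ s$, where $s\colon\sigma_f^*(m)\to\sigma_{L_1f}^*(m)$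 is the map, compatible with the cartesian maps to $m$, determined by universality from $h_{L_1f}\circ s=k_f$. Functoriality is by the universal properties. *)

(* Defs.v *)
From Stdlib Require Import ProofIrrelevance IndefiniteDescription List.

Set Implicit Arguments.
Unset Strict Implicit.
Unset Printing Implicit Defensive.

Record Category := {
  Ob :> Type;
  Hom : Ob -> Ob -> Type;
  idm : forall a, Hom a a;
  comp : forall a b c, Hom b c -> Hom a b -> Hom a c;
  comp_assoc : forall a b c d (f : Hom c d) (g : Hom b c) (h : Hom a b),
    comp f (comp g h) = comp (comp f g) h;
  comp_idl : forall a b (f : Hom a b), comp (idm b) f = f;
  comp_idr : forall a b (f : Hom a b), comp f (idm a) = f
}.

Arguments Hom {_} _ _.
Arguments idm {_} _.
Arguments comp {_ _ _ _} _ _.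

Notation "g ∘ f" := (comp g f) (at level 40, left associativity).

Record Functor (C D : Category) := {
  fob :> C -> D;
  fmap : forall a b, Hom a b -> Hom (fob a) (fob b);
  fmap_id : forall a, fmap (idm a) = idm (fob a);
  fmap_comp : forall a b c (g : Hom b c) (f : Hom a b),
    fmap (g ∘ f) = fmap g ∘ fmap f
}.

Arguments fmap {_ _} _ {_ _} _.

Definition fcomp (C D F : Category) (q : Functor D F) (r : Functor C D) :
  Functor C F.
Proof.
  refine {| fob := fun a => q (r a); fmap := fun a b f => fmap q (fmap r f) |}.
  - intros a; now rewrite !fmap_id.
  - intros a b c g f; now rewrite !fmap_comp.
Defined.

Definition op (C : Category) : Category.
Proof.
  refine {| Ob := Ob C; Hom := fun a b => @Hom C b a; idm := fun a => idm a;
            comp := fun a b c g f => @comp C c b a f g |}.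
  - intros; symmetry; apply comp_assoc.
  - intros; apply comp_idr.
  - intros; apply comp_idl.
Defined.

Definition fop (C D : Category) (q : Functor C D) : Functor (op C) (op D).
Proof.
  refine (@Build_Functor (op C) (op D) (fun a => q a)
            (fun a b f => @fmap C D q b a f) _ _).
  - intros a; exact (fmap_id q a).
  - intros a b c g f; exact (@fmap_comp C D q c b a f g).
Defined.

(** Equality of arrows whose end points are only propositionally equal. *)
Inductive hom_eq (C : Category) (a b : C) (f : Hom a b) :
  forall c d : C, Hom c d -> Prop :=
| hom_eq_refl : hom_eq f f.

Lemma hom_eq_eq (C : Category) (a b : C) (f g : Hom a b) :
  hom_eq f g -> f = g.
Proof.
  intros H.
  assert (K : forall c d (h : Hom c d), hom_eq f h ->
    forall (e1 : c = a) (e2 : d = b),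
      f = eq_rect d (fun y => Hom a y) (eq_rect c (fun x => Hom x d) h a e1) b e2).
  { intros c d h [] e1 e2.
    now rewrite (proof_irrelevance _ e1 eq_refl), (proof_irrelevance _ e2 eq_refl). }
  exact (K _ _ _ H eq_refl eq_refl).
Qed.

Lemma hom_eq_inv (C : Category) (a b : C) (f : Hom a b) c d (g : Hom c d) :
  hom_eq f g -> exists (e1 : a = c) (e2 : b = d),
    g = eq_rect b (fun y => Hom c y) (eq_rect a (fun x => Hom x b) f c e1) d e2.
Proof. intros []; now exists eq_refl, eq_refl. Qed.

Lemma hom_eq_comp (C : Category) (a b c a' b' c' : C)
  (f : Hom a b) (f' : Hom a' b') (g : Hom b c) (g' : Hom b' c') :
  hom_eq f f' -> hom_eq g g' -> hom_eq (g ∘ f) (g' ∘ f').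
Proof.
  intros Hf Hg; destruct Hf.
  destruct (hom_eq_inv Hg) as (e1 & e2 & ->); destruct e2.
  now rewrite (proof_irrelevance _ e1 eq_refl).
Qed.

Lemma hom_eq_sym (C : Category) (a b : C) (f : Hom a b) c d (g : Hom c d) :
  hom_eq f g -> hom_eq g f.
Proof. now intros []. Qed.

Lemma hom_eq_trans (C : Category) (a b : C) (f : Hom a b) c d (g : Hom c d)
  x y (h : Hom x y) : hom_eq f g -> hom_eq g h -> hom_eq f h.
Proof. now intros []. Qed.

Lemma hom_eq_cancelr (C : Category) (a b c : C) (f : Hom a b) (g : Hom b c) (x : C) :
  hom_eq f (idm x) -> hom_eq (g ∘ f) g.
Proof.
  intros H; destruct (hom_eq_inv (hom_eq_sym H)) as (e1 & e2 & ->).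
  destruct e1, e2; cbn; rewrite comp_idr; constructor.
Qed.

Definition is_pullback (C : Category) (X Y V W : C)
  (f : Hom X Y) (h : Hom X V) (k : Hom Y W) (g : Hom V W) : Prop :=
  k ∘ f = g ∘ h /\
  forall Z (a : Hom Z Y) (b : Hom Z V), k ∘ a = g ∘ b ->
    exists! t : Hom Z X, f ∘ t = a /\ h ∘ t = b.

Definition is_pushout (C : Category) (W Y V X : C)
  (k : Hom W Y) (g : Hom W V) (f : Hom Y X) (h : Hom V X) : Prop :=
  f ∘ k = h ∘ g /\
  forall Z (a : Hom Y Z) (b : Hom V Z), a ∘ k = b ∘ g ->
    exists! t : Hom X Z, t ∘ f = a /\ t ∘ h = b.

Definition has_pushouts (C : Category) : Prop :=
  forall (W Y V : C) (k : Hom W Y) (g : Hom W V),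
    exists X (f : Hom Y X) (h : Hom V X), is_pushout k g f h.

Definition preserves_pushouts (C D : Category) (q : Functor C D) : Prop :=
  forall (W Y V X : C) (k : Hom W Y) (g : Hom W V) (f : Hom Y X) (h : Hom V X),
    is_pushout k g f h ->
    is_pushout (fmap q k) (fmap q g) (fmap q f) (fmap q h).

Definition finite_type (T : Type) : Prop := exists l : list T, forall x, In x l.

Definition finite_category (J : Category) : Prop :=
  finite_type J /\ forall a b : J, finite_type (Hom a b).

Definition is_cone (J C : Category) (D : Functor J C) (x : C)
  (leg : forall j, Hom x (D j)) : Prop :=
  forall i j (a : Hom i j), fmap D a ∘ leg i = leg j.

Definition is_limit (J C : Category) (D : Functor J C) (x : C)
  (leg : forall j, Hom x (D j)) : Prop :=
  is_cone leg /\
  forall y (leg' : forall j, Hom y (D j)), is_cone leg' ->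
    exists! t : Hom y x, forall j, leg j ∘ t = leg' j.

Definition has_finite_limits (C : Category) : Prop :=
  forall (J : Category) (D : Functor J C), finite_category J ->
    exists x (leg : forall j, Hom x (D j)), is_limit leg.

Section Fibration.
Variables (E B : Category) (p : Functor E B).

Definition over (X Y : E) (f : Hom X Y) (I J : B) (u : Hom I J) : Prop :=
  hom_eq (fmap p f) u.

Definition vertical (X Y : E) (f : Hom X Y) : Prop := exists I : B, over f (idm I).

Definition cartesian (X Y : E) (f : Hom X Y) : Prop :=
  forall Z (g : Hom Z Y) (w : Hom (p Z) (p X)), fmap p f ∘ w = fmap p g ->
    exists! h : Hom Z X, fmap p h = w /\ f ∘ h = g.

Definition is_fibration : Prop :=
  forall (Y : E) (I : B) (u : Hom I (p Y)),
    exists X (f : Hom X Y), over f u /\ cartesian f.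

Lemma over_comp (X Y Z : E) (f : Hom X Y) (g : Hom Y Z)
  (I J K : B) (u : Hom I J) (v : Hom J K) :
  over f u -> over g v -> over (g ∘ f) (v ∘ u).
Proof. unfold over; rewrite fmap_comp; apply hom_eq_comp. Qed.

Lemma over_vert_comp (X Y Z : E) (f : Hom X Y) (g : Hom Y Z) (I : B) :
  over f (idm I) -> over g (idm I) -> over (g ∘ f) (idm I).
Proof. intros H1 H2; generalize (over_comp H1 H2); now rewrite comp_idl. Qed.

Lemma over_id (X : E) (I : B) (e : p X = I) : over (idm X) (idm I).
Proof. destruct e; unfold over; rewrite fmap_id; constructor. Qed.

Lemma over_src (X Y : E) (f : Hom X Y) I J (u : Hom I J) : over f u -> p X = I.
Proof. now intros []. Qed.

Lemma over_tgt (X Y : E) (f : Hom X Y) I J (u : Hom I J) : over f u -> p Y = J.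
Proof. now intros []. Qed.

Lemma vertical_over (X Y : E) (f : Hom X Y) (I : B) :
  vertical f -> p X = I -> over f (idm I).
Proof. intros [I' H] e; pose proof (over_src H) as e'; now subst. Qed.

Lemma vertical_cancel (X Y Z : E) (f : Hom X Y) (g : Hom Y Z) :
  vertical f -> vertical (g ∘ f) -> vertical g.
Proof.
  intros [I Hf] Hgf; exists I.
  pose proof (vertical_over Hgf (over_src Hf)) as Hgf'.
  unfold over in *; rewrite fmap_comp in Hgf'.
  exact (hom_eq_trans (hom_eq_sym (hom_eq_cancelr _ Hf)) Hgf').
Qed.

Lemma cartesian_over (X Y : E) (f : Hom X Y) (I J : B) (u : Hom J I) :
  over f u -> cartesian f ->
  forall (Z : E) (K : B) (w : Hom K J) (g : Hom Z Y), over g (u ∘ w) ->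
    exists! h : Hom Z X, over h w /\ f ∘ h = g.
Proof.
  intros Hf Cf Z K w g Hg; destruct Hf; unfold over in *.
  pose proof (over_src Hg) as e; destruct e.
  apply hom_eq_eq in Hg.
  destruct (Cf Z g w (eq_sym Hg)) as (h & (H1 & H2) & U).
  exists h; split; [split; [rewrite H1; constructor | exact H2] |].
  intros h' [H1' H2']; apply U; split; [now apply hom_eq_eq | exact H2'].
Qed.

Record fibre_ob (I : B) := { fib_ob :> E; fib_eq : p fib_ob = I }.

Record fibre_hom (I : B) (X Y : fibre_ob I) :=
  { fib_map :> Hom (fib_ob X) (fib_ob Y); fib_over : over fib_map (idm I) }.

Lemma fibre_hom_eq (I : B) (X Y : fibre_ob I) (f g : fibre_hom X Y) :
  fib_map f = fib_map g -> f = g.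
Proof.
  destruct f as [f Hf], g as [g Hg]; cbn; intros e; subst.
  f_equal; apply proof_irrelevance.
Qed.

Definition Fibre (I : B) : Category.
Proof.
  refine {| Ob := fibre_ob I; Hom := @fibre_hom I;
            idm := fun X => {| fib_map := idm (fib_ob X); fib_over := over_id (fib_eq X) |};
            comp := fun X Y Z g f =>
              {| fib_map := fib_map g ∘ fib_map f;
                 fib_over := over_vert_comp (fib_over f) (fib_over g) |} |}.
  - intros; apply fibre_hom_eq; cbn; apply comp_assoc.
  - intros; apply fibre_hom_eq; cbn; apply comp_idl.
  - intros; apply fibre_hom_eq; cbn; apply comp_idr.
Defined.

Record Cleavage := {
  cl_ob : forall (I J : B) (u : Hom J I), Fibre I -> Fibre J;
  cl_map : forall (I J : B) (u : Hom J I) (X : Fibre I),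
    Hom (fib_ob (cl_ob u X)) (fib_ob X);
  cl_over : forall (I J : B) (u : Hom J I) (X : Fibre I), over (cl_map u X) u;
  cl_cart : forall (I J : B) (u : Hom J I) (X : Fibre I), cartesian (cl_map u X)
}.

End Fibration.

Arguments cl_ob {E B p} c {I J} u X.
Arguments cl_map {E B p} c {I J} u X.
Arguments cl_over {E B p} c {I J} u X.
Arguments cl_cart {E B p} c {I J} u X.

Definition opcartesian (E B : Category) (p : Functor E B) (X Y : E) (f : Hom X Y) :
  Prop := @cartesian (op E) (op B) (fop p) Y X f.

Definition is_bifibration (E B : Category) (p : Functor E B) : Prop :=
  is_fibration p /\ is_fibration (fop p).

Definition beck_chevalley (E B : Category) (p : Functor E B) : Prop :=
  forall (X Y V W : E) (f : Hom X Y) (h : Hom X V) (g : Hom V W) (k : Hom Y W),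
    g ∘ h = k ∘ f ->
    is_pullback (fmap p f) (fmap p h) (fmap p k) (fmap p g) ->
    cartesian p g -> opcartesian p k ->
    (opcartesian p h <-> cartesian p f).

Section Reindexing.
Variables (E B : Category) (p : Functor E B) (c : Cleavage p).

Section Lift.
Variables (I J K : B) (u : Hom J I) (w : Hom K J) (X : Fibre p I) (Z : E)
  (g : Hom Z (fib_ob X)) (Hg : over p g (u ∘ w)).

Definition cl_lift_sig :
  {h : Hom Z (fib_ob (cl_ob c u X)) | over p h w /\ cl_map c u X ∘ h = g}.
Proof.
  apply constructive_indefinite_description.
  destruct (cartesian_over (cl_over c u X) (cl_cart c u X) Hg) as (h & Hh & _).
  now exists h.
Defined.

Definition cl_lift : Hom Z (fib_ob (cl_ob c u X)) := proj1_sig cl_lift_sig.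

Lemma cl_lift_over : over p cl_lift w.
Proof. exact (proj1 (proj2_sig cl_lift_sig)). Qed.

Lemma cl_liftK : cl_map c u X ∘ cl_lift = g.
Proof. exact (proj2 (proj2_sig cl_lift_sig)). Qed.

Lemma cl_lift_uniq (h : Hom Z (fib_ob (cl_ob c u X))) :
  over p h w -> cl_map c u X ∘ h = g -> h = cl_lift.
Proof.
  intros H1 H2.
  destruct (cartesian_over (cl_over c u X) (cl_cart c u X) Hg) as (h0 & _ & U).
  rewrite <- (U h), <- (U cl_lift); auto using cl_lift_over, cl_liftK.
Qed.

End Lift.

Lemma comparison_over (I J K : B) (u : Hom J I) (u' : Hom K I) (t : Hom K J)
  (e : u ∘ t = u') (X : Fibre p I) : over p (cl_map c u' X) (u ∘ t).
Proof. rewrite e; apply cl_over. Qed.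

(** The canonical map [u'^*X -> u^*X] over [t], where [u' = u ∘ t]. *)
Definition comparison (I J K : B) (u : Hom J I) (u' : Hom K I) (t : Hom K J)
  (e : u ∘ t = u') (X : Fibre p I) :
  Hom (fib_ob (cl_ob c u' X)) (fib_ob (cl_ob c u X)) :=
  cl_lift (comparison_over e X).

Lemma reindex_over (I J : B) (u : Hom J I) (X Y : Fibre p I) (f : Hom X Y) :
  over p (fib_map f ∘ cl_map c u X) (u ∘ idm J).
Proof.
  pose proof (over_comp (cl_over c u X) (fib_over f)) as H.
  now rewrite comp_idl in H; rewrite comp_idr.
Qed.

Definition reindex_map (I J : B) (u : Hom J I) (X Y : Fibre p I) (f : Hom X Y) :
  @Hom (Fibre p J) (cl_ob c u X) (cl_ob c u Y) :=
  {| fib_map := cl_lift (reindex_over u f); fib_over := cl_lift_over _ |}.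

Definition reindex (I J : B) (u : Hom J I) : Functor (Fibre p I) (Fibre p J).
Proof.
  refine {| fob := cl_ob c u : Fibre p I -> Fibre p J;
            fmap := fun X Y f => reindex_map u f |}.
  - intros X; apply fibre_hom_eq; cbn; symmetry; apply cl_lift_uniq.
    + apply over_id, fib_eq.
    + cbn; now rewrite comp_idr, comp_idl.
  - intros X Y Z g f; apply fibre_hom_eq; cbn; symmetry; apply cl_lift_uniq.
    + apply over_vert_comp; apply cl_lift_over.
    + cbn; now rewrite comp_assoc, cl_liftK, <- comp_assoc, cl_liftK, comp_assoc.
Defined.

Definition has_fibred_pushouts : Prop :=
  (forall I : B, has_pushouts (Fibre p I)) /\
  (forall (I J : B) (u : Hom J I), preserves_pushouts (reindex u)).

(** Maps from [u] to [s] in the slice over [I]. *)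
Definition slice_hom (I J H : B) (u : Hom J I) (s : Hom H I) : Type :=
  {t : Hom J H | s ∘ t = u}.

Definition slice_comp (I J J' H : B) (u : Hom J I) (u' : Hom J' I) (s : Hom H I)
  (t : slice_hom u s) (r : slice_hom u' u) : slice_hom u' s.
Proof.
  exists (proj1_sig t ∘ proj1_sig r).
  now rewrite comp_assoc, (proj2_sig t), (proj2_sig r).
Defined.

(** [h'] is the image of [h] under the action of [r] on
    [(u : J -> I) |-> E_J (u^*X, u^*Y)]. *)
Definition restricts_to (I J J' : B) (X Y : Fibre p I) (u : Hom J I) (u' : Hom J' I)
  (r : slice_hom u' u) (h : Hom (reindex u X) (reindex u Y))
  (h' : Hom (reindex u' X) (reindex u' Y)) : Prop :=
  comparison (proj2_sig r) Y ∘ fib_map h' = fib_map h ∘ comparison (proj2_sig r) X.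

(** For all [X], [Y] over [I] there are a representing object [s : H -> I] and a
    natural bijection [(B/I)(u, s) -> E_J (u^*X, u^*Y)]. *)
Definition locally_small : Prop :=
  forall (I : B) (X Y : Fibre p I),
    exists (H : B) (s : Hom H I)
      (phi : forall (J : B) (u : Hom J I),
         slice_hom u s -> Hom (reindex u X) (reindex u Y)),
      (forall (J : B) (u : Hom J I) (h : Hom (reindex u X) (reindex u Y)),
         exists! t, phi J u t = h) /\
      (forall (J J' : B) (u : Hom J I) (u' : Hom J' I)
         (t : slice_hom u s) (r : slice_hom u' u),
         restricts_to r (phi J u t) (phi J' u' (slice_comp t r))).

End Reindexing.

Section Vertical.
Variables (E B : Category) (p : Functor E B).

Record vert_ob := {
  dom : E;
  cod : E;
  arr : Hom dom cod;
  arr_vertical : vertical p arr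
}.

Record square (f g : vert_ob) := {
  sq_dom : Hom (dom f) (dom g);
  sq_cod : Hom (cod f) (cod g);
  sq_comm : arr g ∘ sq_dom = sq_cod ∘ arr f
}.

Lemma square_eq (f g : vert_ob) (a b : square f g) :
  sq_dom a = sq_dom b -> sq_cod a = sq_cod b -> a = b.
Proof.
  destruct a as [a1 a2 Ha], b as [b1 b2 Hb]; cbn; intros; subst.
  f_equal; apply proof_irrelevance.
Qed.

Definition square_id (f : vert_ob) : square f f.
Proof.
  exists (idm _) (idm _); now rewrite comp_idl, comp_idr.
Defined.

Definition square_comp (f g h : vert_ob) (b : square g h) (a : square f g) :
  square f h.
Proof.
  exists (sq_dom b ∘ sq_dom a) (sq_cod b ∘ sq_cod a).
  now rewrite comp_assoc, sq_comm, <- comp_assoc, sq_comm, comp_assoc.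
Defined.

Definition Vert : Category.
Proof.
  refine {| Ob := vert_ob; Hom := square; idm := square_id; comp := square_comp |}.
  - intros; apply square_eq; apply comp_assoc.
  - intros; apply square_eq; apply comp_idl.
  - intros; apply square_eq; apply comp_idr.
Defined.

Definition domF : Functor Vert E.
Proof.
  refine {| fob := dom : Vert -> E; fmap := fun f g (a : @Hom Vert f g) => sq_dom a |};
    reflexivity.
Defined.

Definition pdom : Functor Vert B := fcomp p domF.

Section Levels.
Variables (I : B) (f : Fibre pdom I).

Lemma level_over : over p (arr (fib_ob f)) (idm I).
Proof. apply vertical_over; [apply arr_vertical | exact (fib_eq f)]. Qed.

Definition level_dom : Fibre p I :=
  {| fib_ob := dom (fib_ob f); fib_eq := fib_eq f : p (dom (fib_ob f)) = I |}.

Definition level_cod : Fibre p I :=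
  {| fib_ob := cod (fib_ob f); fib_eq := over_tgt level_over |}.

Definition level_arr : Hom level_dom level_cod :=
  {| fib_map := arr (fib_ob f) : Hom (fib_ob level_dom) (fib_ob level_cod);
     fib_over := level_over |}.

End Levels.

Lemma square_cod_over (f g : Vert) (a : Hom f g) (I J : B) (u : Hom I J) :
  over pdom a u -> over p (sq_cod a) u.
Proof.
  intros H.
  assert (Hf : over p (arr f) (idm I)).
  { apply vertical_over; [apply arr_vertical | exact (over_src H)]. }
  assert (Hg : over p (arr g) (idm J)).
  { apply vertical_over; [apply arr_vertical | exact (over_tgt H)]. }
  pose proof (over_comp (H : over p (sq_dom a) u) Hg) as K.
  rewrite sq_comm, comp_idl in K.
  unfold over in *; rewrite fmap_comp in K.
  exact (hom_eq_trans (hom_eq_sym (hom_eq_cancelr _ Hf)) K).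
Qed.

Variable c : Cleavage p.

Section Levelwise.
Variables (I J : B) (u : Hom J I) (f : Fibre pdom I).

Definition vreindex_ob : Vert.
Proof.
  refine {| dom := fib_ob (reindex c u (level_dom f));
            cod := fib_ob (reindex c u (level_cod f));
            arr := fib_map (fmap (reindex c u) (level_arr f)) |}.
  exists J; apply fib_over.
Defined.

Definition vreindex : Fibre pdom J :=
  {| fib_ob := vreindex_ob;
     fib_eq := fib_eq (reindex c u (level_dom f)) : pdom vreindex_ob = J |}.

Definition vreindex_map : Hom (fib_ob vreindex) (fib_ob f).
Proof.
  refine (@Build_square vreindex_ob (fib_ob f)
            (cl_map c u (level_dom f)) (cl_map c u (level_cod f)) _).
  cbn; symmetry; apply (cl_liftK c (reindex_over c u (level_arr f))).
Defined.

Lemma vreindex_over : over pdom vreindex_map u.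
Proof. exact (cl_over c u (level_dom f)). Qed.

Lemma vreindex_cart : cartesian pdom vreindex_map.
Proof.
  intros z g w Hw.
  destruct (cl_cart c u (level_dom f) (dom z) (sq_dom g) w Hw) as (h1 & (Ph1 & Ch1) & U1).
  set (f1 := level_dom f) in *; set (f2 := level_cod f) in *.
  assert (Oh1 : over p h1 w) by (unfold over; rewrite Ph1; constructor).
  pose proof (fib_eq (reindex c u f1)) as eJ; cbn in eJ.
  pose (w' := eq_rect _ (fun y => Hom (pdom z) y) w J eJ : Hom (pdom z) J).
  assert (Hw' : hom_eq w w').
  { unfold w'; clear; destruct eJ; constructor. }
  assert (Oh1' : over p h1 w') by exact (hom_eq_trans Oh1 Hw').
  assert (Og : over pdom g (u ∘ w')).
  { unfold over; rewrite <- Hw.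
    apply hom_eq_comp; [exact Hw' | exact vreindex_over]. }
  pose proof (square_cod_over Og) as Og2.
  pose proof (cl_liftK c (X := f2) Og2) as Ch2.
  pose proof (cl_lift_over c (X := f2) Og2) as Oh2.
  set (h2 := cl_lift c (X := f2) Og2) in *.
  assert (Oz : over p (arr z) (idm (pdom z)))
    by (apply vertical_over; [apply arr_vertical | reflexivity]).
  assert (Hc : arr vreindex_ob ∘ h1 = h2 ∘ arr z).
  { assert (Og3 : over p (sq_cod g ∘ arr z) (u ∘ w')).
    { rewrite <- (comp_idr (u ∘ w')); now apply over_comp. }
    rewrite (@cl_lift_uniq _ _ _ c _ _ _ u w' f2 _ _ Og3 (arr vreindex_ob ∘ h1)).
    - symmetry; apply cl_lift_uniq.
      + rewrite <- (comp_idr w'); now apply over_comp.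
      + now rewrite comp_assoc, Ch2.
    - rewrite <- (comp_idl w'); apply over_comp; [exact Oh1' | apply cl_lift_over].
    - rewrite comp_assoc.
      transitivity ((arr (fib_ob f) ∘ cl_map c u f1) ∘ h1).
      + apply (f_equal (fun k => k ∘ h1)); symmetry; exact (sq_comm vreindex_map).
      + rewrite <- comp_assoc.
        transitivity (arr (fib_ob f) ∘ sq_dom g); [|apply sq_comm].
        apply f_equal; exact Ch1. }
  exists (@Build_square z vreindex_ob h1 h2 Hc); split.
  - split; [exact Ph1 | apply square_eq; [exact Ch1 | exact Ch2]].
  - intros h' [Ph' Ch']; apply square_eq; cbn.
    + apply U1; split; [exact Ph' | exact (f_equal (fun s : square _ _ => sq_dom s) Ch')].
    + symmetry; apply cl_lift_uniq.
      * apply (square_cod_over (a := h')); unfold over; rewrite Ph'; exact Hw'.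
      * exact (f_equal (fun s : square _ _ => sq_cod s) Ch').
Qed.

End Levelwise.

Definition vcleavage : Cleavage pdom :=
  {| cl_ob := vreindex; cl_map := vreindex_map;
     cl_over := vreindex_over; cl_cart := vreindex_cart |}.

End Vertical.

Section Lawfs.
Variables (E B : Category) (p : Functor E B).

Record factorisation := {
  fac_K : Vert p -> E;
  fac_L : forall f : Vert p, Hom (dom f) (fac_K f);
  fac_R : forall f : Vert p, Hom (fac_K f) (cod f);
  fac_L_vertical : forall f, vertical p (fac_L f);
  fac_R_vertical : forall f, vertical p (fac_R f);
  fac_comp : forall f, fac_R f ∘ fac_L f = arr f
}.

Section Factorisation.
Variable F : factorisation.

Definition left_ob (f : Vert p) : Vert p :=
  {| dom := dom f; cod := fac_K F f; arr := fac_L F f;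
     arr_vertical := fac_L_vertical F f |}.

Definition counit (f : Vert p) : Hom (left_ob f) f.
Proof.
  refine (@Build_square _ _ p (left_ob f) f (idm (dom f)) (fac_R F f) _).
  cbn; now rewrite comp_idr, fac_comp.
Defined.

Variable Kmap : forall f g : Vert p, Hom f g -> Hom (fac_K F f) (fac_K F g).

Record functorial_factorisation : Prop := {
  ff_L : forall (f g : Vert p) (a : Hom f g),
    fac_L F g ∘ sq_dom a = Kmap a ∘ fac_L F f;
  ff_R : forall (f g : Vert p) (a : Hom f g),
    fac_R F g ∘ Kmap a = sq_cod a ∘ fac_R F f;
  ff_id : forall f : Vert p, Kmap (idm f) = idm (fac_K F f);
  ff_comp : forall (f g h : Vert p) (b : Hom g h) (a : Hom f g),
    Kmap (b ∘ a) = Kmap b ∘ Kmap a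
}.

Definition left_functor (H : functorial_factorisation) : Functor (Vert p) (Vert p).
Proof.
  refine (@Build_Functor (Vert p) (Vert p) left_ob
    (fun f g a => @Build_square _ _ p (left_ob f) (left_ob g)
       (sq_dom a) (Kmap a) (ff_L H a)) _ _).
  - intros f; apply square_eq; [reflexivity | exact (ff_id H f)].
  - intros f g h b a; apply square_eq; [reflexivity | exact (ff_comp H b a)].
Defined.

End Factorisation.

Record is_comonad (C : Category) (T : Functor C C)
  (eps : forall x : C, Hom (T x) x) (del : forall x : C, Hom (T x) (T (T x))) : Prop := {
  eps_natural : forall (x y : C) (a : Hom x y), eps y ∘ fmap T a = a ∘ eps x;
  del_natural : forall (x y : C) (a : Hom x y),
    del y ∘ fmap T a = fmap T (fmap T a) ∘ del x;
  counit_left : forall x : C, eps (T x) ∘ del x = idm (T x);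
  counit_right : forall x : C, fmap T (eps x) ∘ del x = idm (T x);
  coassociative : forall x : C, del (T x) ∘ del x = fmap T (del x) ∘ del x
}.

Definition preserves_cartesian (C C' : Category) (q : Functor C B) (q' : Functor C' B)
  (T : Functor C C') : Prop :=
  forall (x y : C) (a : Hom x y), cartesian q a -> cartesian q' (fmap T a).

(** The comonad lies over [dom]: [left_functor] and [counit] do by construction,
    and the domain components of the comultiplication are required to be identities. *)
Definition is_lawfs (F : factorisation)
  (Kmap : forall f g : Vert p, Hom f g -> Hom (fac_K F f) (fac_K F g))
  (Sigma : forall f : Vert p, Hom (left_ob F f) (left_ob F (left_ob F f))) : Prop :=
  exists H : functorial_factorisation Kmap,
    (forall f : Vert p, sq_dom (Sigma f) = idm (dom f)) /\
    @is_comonad (Vert p) (left_functor H) (counit F) Sigma.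

(** Preservation of cartesian maps by [f |-> (Lf, Rf)] is expressed through [L], which
    maps [(a, b)] to [(a, K (a, b))]. *)
Definition is_fibred_lawfs (F : factorisation)
  (Kmap : forall f g : Vert p, Hom f g -> Hom (fac_K F f) (fac_K F g))
  (Sigma : forall f : Vert p, Hom (left_ob F f) (left_ob F (left_ob F f))) : Prop :=
  is_lawfs Kmap Sigma /\
  forall H : functorial_factorisation Kmap,
    preserves_cartesian (pdom p) (pdom p) (left_functor H).

End Lawfs.

Section StepOne.
Variables (E B : Category) (p : Functor E B) (c : Cleavage p) (m : Vert p).

Definition m_fib : Fibre (pdom p) (pdom p m) := {| fib_ob := m; fib_eq := eq_refl |}.

Definition pull (K : B) (sigma : Hom K (pdom p m)) : Vert p :=
  fib_ob (cl_ob (vcleavage c) sigma m_fib).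

Definition pull_map (K : B) (sigma : Hom K (pdom p m)) : Hom (pull sigma) m :=
  cl_map (vcleavage c) sigma m_fib.

Record universal_lifting_problem (f : Vert p) := {
  lp_hom : B;
  lp_sigma : Hom lp_hom (pdom p m);
  lp_tau : Hom lp_hom (pdom p f);
  lp_map : Hom (pull lp_sigma) f;
  lp_over : over (pdom p) lp_map lp_tau;
  lp_universal : forall (K : B) (sigma : Hom K (pdom p m)) (tau : Hom K (pdom p f))
      (h : Hom (pull sigma) f), over (pdom p) h tau ->
    exists! t : Hom K lp_hom,
      exists e : lp_sigma ∘ t = sigma,
        lp_tau ∘ t = tau /\ h = lp_map ∘ comparison (vcleavage c) e m_fib
}.

(** Universal lifting problems, pushforwards and opcartesian maps are determined only
    up to isomorphism; the record is one choice of them for all [f]. *)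
Record step_one_choice := {
  so_lp : forall f : Vert p, universal_lifting_problem f;
  so_K : Vert p -> E;
  so_L : forall f : Vert p, Hom (dom f) (so_K f);
  so_L_vertical : forall f : Vert p, vertical p (so_L f);
  so_left := (fun f : Vert p =>
    {| dom := dom f; cod := so_K f; arr := so_L f; arr_vertical := so_L_vertical f |}
    : Vert p);
  so_k : forall f : Vert p, Hom (pull (lp_sigma (so_lp f))) (so_left f);
  so_k_opcartesian : forall f : Vert p, opcartesian (domF p) (so_k f);
  so_eps : forall f : Vert p, Hom (so_left f) f;
  so_eps_dom : forall f : Vert p, sq_dom (so_eps f) = idm (dom f);
  so_eps_k : forall f : Vert p, lp_map (so_lp f) = so_eps f ∘ so_k f
}.

Section Choice.
Variable S : step_one_choice.

Lemma so_factors (f : Vert p) : sq_cod (so_eps S f) ∘ so_L S f = arr f.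
Proof.
  transitivity (arr f ∘ sq_dom (so_eps S f)).
  - symmetry; exact (sq_comm (so_eps S f)).
  - rewrite so_eps_dom; apply comp_idr.
Qed.

Lemma so_R_vertical (f : Vert p) : vertical p (sq_cod (so_eps S f)).
Proof.
  apply (@vertical_cancel _ _ p _ _ _ (so_L S f)); [apply so_L_vertical|].
  exact (eq_ind_r (fun a => vertical p a) (arr_vertical f) (so_factors f)).
Qed.

Definition so_fac : factorisation p :=
  {| fac_K := so_K S; fac_L := so_L S; fac_R := fun f => sq_cod (so_eps S f);
     fac_L_vertical := so_L_vertical S; fac_R_vertical := so_R_vertical;
     fac_comp := so_factors |}.

(** [s] is the map between the pullbacks of [m] induced by the lifting problem [x]
    from [m] to [g]. *)
Definition induced (K : B) (sigma : Hom K (pdom p m)) (g : Vert p) (x : Hom (pull sigma) g)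
  (s : Hom (pull sigma) (pull (lp_sigma (so_lp S g)))) : Prop :=
  pull_map (lp_sigma (so_lp S g)) ∘ s = pull_map sigma /\
  lp_map (so_lp S g) ∘ s = x.

(** The map out of [L_1 f] with domain component [d] that is determined by the
    lifting problem [x] from [m] to [g], through the opcartesian [k_f]. *)
Definition extends (f g : Vert p) (d : Hom (dom f) (dom g))
  (x : Hom (pull (lp_sigma (so_lp S f))) g)
  (l : Hom (left_ob so_fac f) (left_ob so_fac g)) : Prop :=
  sq_dom l = d /\
  exists s, unique (induced x) s /\ l ∘ so_k S f = so_k S g ∘ s.

End Choice.

Record step_one := {
  so_choice :> step_one_choice;
  so_map : forall f g : Vert p, Hom f g ->
    Hom (left_ob (so_fac so_choice) f) (left_ob (so_fac so_choice) g);
  so_map_spec : forall (f g : Vert p) (a : Hom f g),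
    unique (extends (sq_dom a) (a ∘ lp_map (so_lp so_choice f))) (so_map a);
  so_comult : forall f : Vert p,
    Hom (left_ob (so_fac so_choice) f)
        (left_ob (so_fac so_choice) (left_ob (so_fac so_choice) f));
  so_comult_spec : forall f : Vert p,
    unique (extends (g := left_ob (so_fac so_choice) f) (idm (dom f))
              (so_k so_choice f))
           (so_comult f)
}.

Definition so_Kmap (S : step_one) (f g : Vert p) (a : Hom f g) :
  Hom (fac_K (so_fac S) f) (fac_K (so_fac S) g) := sq_cod (so_map S a).

End StepOne.

(* Main.v *)
(** A lifting problem from [m] to [f] is a span [m <- Z -> f] in [V(E)] whose left leg is
    cartesian, so [Hom(m, f)] carries a universal such span.  A square is opcartesian over
    [dom] exactly when it is a pushout in [E].  Hence maps out of [L_1 f] are detected on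
    the domain and on [k_f], and maps into [sigma_f^* m] on [m] and on [f]; this gives
    functoriality and the comonad laws.

    For fibredness, let [a : f -> g] be cartesian.  Then [Hom(m, f)] is the pullback of
    [Hom(m, g)] along the base of [a].  The pushout defining [L_1 g] decomposes into an
    opcartesian pushforward along [tau_g] followed by a pushout in a fibre.  Reindexing
    along the base of [a] carries the first to the pushforward along [tau_f], by
    Beck-Chevalley, and preserves the second, so it carries [L_1 g] to [L_1 f]. *)

From Stdlib Require Import ProofIrrelevance IndefiniteDescription List.
Require Import Defs.

Set Implicit Arguments.
Unset Strict Implicit.
Unset Printing Implicit Defensive.

(** * Pushouts and finite limits *)

(** Objects of a fibre satisfy [p X = I] only propositionally, so a vertical map is sent to an
    identity only up to transport. Base arrows are therefore recorded by [over], and many arguments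
    use only that the image of a vertical map is invertible. Universal properties are likewise moved
    out of the chosen fibres: lifting problems become universal spans, pushouts in a fibre become
    pushouts in E, and comparison isomorphisms transfer results between arbitrary cartesian maps and
    the chosen lifts. Two gaps separate the hypotheses from the construction. Local smallness
    represents maps of E between objects of one fibre, whereas Hom(m, f) represents squares between
    objects over different bases; a product of bases closes the first difference, and a pullback
    expressing commutativity closes the second. Pushouts are assumed in fibres only, whereas the
    domain component of the universal lifting problem lies over tau_f; pushing forward along tau_f
    first brings the span to be completed into one fibre. *)

Definition is_iso (C : Category) (a b : C) (f : Hom a b) : Prop :=
  exists g : Hom b a, f ∘ g = idm b /\ g ∘ f = idm a.

Lemma iso_op (C : Category) (a b : C) (f : Hom a b) :
  is_iso f -> @is_iso (op C) b a f.
Proof. intros (g & H1 & H2); exists g; split; assumption. Qed.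

Lemma iso_id (C : Category) (a : C) : is_iso (idm a).
Proof. exists (idm a); split; apply comp_idl. Qed.

(** Invertibility is what remains of being an identity once the transports between end points are
    forgotten. *)
Lemma hom_eq_id_iso (C : Category) (a b x : C) (f : Hom a b) :
  hom_eq f (idm x) -> is_iso f.
Proof.
  intros H; destruct (hom_eq_inv (hom_eq_sym H)) as (e1 & e2 & ->).
  destruct e1, e2; apply iso_id.
Qed.

Lemma hom_eq_op (C : Category) (a b c d : C) (f : Hom a b) (g : Hom c d) :
  hom_eq f g -> @hom_eq (op C) b a f d c g.
Proof. intros []; constructor. Qed.

Lemma hom_eq_of_op (C : Category) (a b c d : C) (f : Hom a b) (g : Hom c d) :
  @hom_eq (op C) b a f d c g -> hom_eq f g.
Proof. intros H; destruct H; constructor. Qed.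

Section Pushouts.
Variable C : Category.

Lemma pushout_uniq (W Y V X Z : C) (k : Hom W Y) (g : Hom W V) (f : Hom Y X)
  (h : Hom V X) (t t' : Hom X Z) :
  is_pushout k g f h -> t ∘ f = t' ∘ f -> t ∘ h = t' ∘ h -> t = t'.
Proof.
  intros [Hc Hu] H1 H2.
  destruct (Hu Z (t ∘ f) (t ∘ h)) as (t0 & _ & U).
  { now rewrite <- !comp_assoc, Hc. }
  rewrite <- (U t), <- (U t'); auto.
Qed.

Lemma pushout_paste (A A' D D' X K : C) (m : Hom A D) (k1 : Hom A A')
  (k2 : Hom D D') (m' : Hom A' D') (v : Hom A' X) (n : Hom D' K) (l : Hom X K) :
  is_pushout m k1 k2 m' -> is_pushout m' v n l ->
  is_pushout m (v ∘ k1) (n ∘ k2) l.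
Proof.
  intros P1 P2; pose proof P1 as [C1 U1]; pose proof P2 as [C2 U2]; split.
  - now rewrite <- comp_assoc, C1, !comp_assoc, C2.
  - intros Z a b Hab.
    destruct (U1 Z a (b ∘ v)) as (t1 & [T1 T2] & _).
    { now rewrite <- comp_assoc. }
    destruct (U2 Z t1 b T2) as (t & [T3 T4] & _).
    exists t; split; [split|].
    + now rewrite comp_assoc, T3.
    + exact T4.
    + intros t' [H1 H2]; apply (pushout_uniq P2).
      * apply (pushout_uniq P1).
        -- now rewrite T3, T1, <- comp_assoc.
        -- now rewrite <- !comp_assoc, C2, !comp_assoc, T4, H2.
      * now rewrite T4.
Qed.

(** The converse direction of pasting; it peels a pushforward square off a pushout and leaves a
    pushout inside a fibre. *)
Lemma pushout_cancel (A A' D D' X K : C) (m : Hom A D) (k1 : Hom A A')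
  (k2 : Hom D D') (m' : Hom A' D') (v : Hom A' X) (n : Hom D' K) (l : Hom X K) :
  is_pushout m k1 k2 m' -> n ∘ m' = l ∘ v ->
  is_pushout m (v ∘ k1) (n ∘ k2) l -> is_pushout m' v n l.
Proof.
  intros P1 C2 P; pose proof P1 as [C1 U1]; pose proof P as [C0 U0]; split.
  - exact C2.
  - intros Z a b Hab.
    destruct (U0 Z (a ∘ k2) b) as (t & [T1 T2] & U).
    { now rewrite <- comp_assoc, C1, !comp_assoc, Hab. }
    exists t; split; [split|].
    + apply (pushout_uniq P1).
      * now rewrite <- comp_assoc.
      * now rewrite <- comp_assoc, C2, comp_assoc, T2.
    + exact T2.
    + intros t' [H1 H2]; apply U; split; [now rewrite comp_assoc, H1 | exact H2].
Qed.

Lemma pushout_iso (W Y V X W' Y' V' X' : C)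
  (k : Hom W Y) (g : Hom W V) (f : Hom Y X) (h : Hom V X)
  (k' : Hom W' Y') (g' : Hom W' V') (f' : Hom Y' X') (h' : Hom V' X')
  (w : Hom W' W) (y : Hom Y' Y) (v : Hom V' V) (x : Hom X' X) :
  is_pushout k g f h -> is_iso w -> is_iso y -> is_iso v -> is_iso x ->
  y ∘ k' = k ∘ w -> v ∘ g' = g ∘ w -> x ∘ f' = f ∘ y -> x ∘ h' = h ∘ v ->
  is_pushout k' g' f' h'.
Proof.
  intros P (w1 & W1 & W2) (y1 & Y1 & Y2) (v1 & V1 & V2) (x1 & X1 & X2) Hk Hg Hf Hh.
  pose proof P as [Hc U]; split.
  - rewrite <- (comp_idl (f' ∘ k')), <- (comp_idl (h' ∘ g')), <- X2.
    rewrite <- !comp_assoc; f_equal.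
    rewrite !comp_assoc, Hf, Hh, <- !comp_assoc, Hk, Hg, !comp_assoc.
    now rewrite Hc.
  - intros Z a b Hab.
    destruct (U Z (a ∘ y1) (b ∘ v1)) as (t & [T1 T2] & Ut).
    { rewrite <- (comp_idr (_ ∘ k)), <- (comp_idr (_ ∘ g)), <- W1, !comp_assoc.
      rewrite <- (comp_assoc _ k w), <- (comp_assoc _ g w), <- Hk, <- Hg, !comp_assoc.
      rewrite <- (comp_assoc a), <- (comp_assoc b), Y2, V2, !comp_idr.
      now rewrite Hab. }
    exists (t ∘ x); split; [split|].
    + now rewrite <- comp_assoc, Hf, comp_assoc, T1, <- comp_assoc, Y2, comp_idr.
    + now rewrite <- comp_assoc, Hh, comp_assoc, T2, <- comp_assoc, V2, comp_idr.
    + intros t' [H1 H2]; rewrite (Ut (t' ∘ x1)).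
      * now rewrite <- comp_assoc, X2, comp_idr.
      * rewrite <- H1, <- H2, <- !comp_assoc; split; f_equal.
        -- rewrite <- (comp_idr (x1 ∘ f)), <- Y1, !comp_assoc.
           rewrite <- (comp_assoc x1), <- Hf, !comp_assoc, X2, comp_idl; reflexivity.
        -- rewrite <- (comp_idr (x1 ∘ h)), <- V1, !comp_assoc.
           rewrite <- (comp_assoc x1), <- Hh, !comp_assoc, X2, comp_idl; reflexivity.
Qed.

Lemma pushout_unique_iso (W Y V X X' : C) (k : Hom W Y) (g : Hom W V)
  (f : Hom Y X) (h : Hom V X) (f' : Hom Y X') (h' : Hom V X') :
  is_pushout k g f h -> is_pushout k g f' h' ->
  exists t : Hom X X', is_iso t /\ t ∘ f = f' /\ t ∘ h = h'.
Proof.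
  intros P P'; pose proof P as [Hc U]; pose proof P' as [Hc' U'].
  destruct (U _ f' h' Hc') as (t & [T1 T2] & _).
  destruct (U' _ f h Hc) as (t' & [T1' T2'] & _).
  exists t; split; [exists t'; split | now split].
  - apply (pushout_uniq P'); rewrite comp_idl, <- comp_assoc.
    + now rewrite T1'.
    + now rewrite T2'.
  - apply (pushout_uniq P); rewrite comp_idl, <- comp_assoc.
    + now rewrite T1.
    + now rewrite T2.
Qed.

End Pushouts.

(** Pullbacks in [C] are by conversion pushouts in [op C], so the statement for pushouts applies
    with all comparison isomorphisms reversed. *)
Lemma pullback_iso (C : Category) (X Y V W X' Y' V' W' : C)
  (f : Hom X Y) (h : Hom X V) (k : Hom Y W) (g : Hom V W)
  (f' : Hom X' Y') (h' : Hom X' V') (k' : Hom Y' W') (g' : Hom V' W')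
  (x : Hom X X') (y : Hom Y Y') (v : Hom V V') (w : Hom W W') :
  is_pullback f h k g -> is_iso x -> is_iso y -> is_iso v -> is_iso w ->
  f' ∘ x = y ∘ f -> h' ∘ x = v ∘ h -> k' ∘ y = w ∘ k -> g' ∘ v = w ∘ g ->
  is_pullback f' h' k' g'.
Proof.
  intros P Ix Iy Iv Iw Hf Hh Hk Hg.
  refine (@pushout_iso (op C) W Y V X W' Y' V' X' k g f h k' g' f' h' w y v x
    P (iso_op Iw) (iso_op Iy) (iso_op Iv) (iso_op Ix) Hk Hg Hf Hh).
Qed.

Lemma pullback_iso_inv (C : Category) (X Y V W X' Y' V' W' : C)
  (f : Hom X Y) (h : Hom X V) (k : Hom Y W) (g : Hom V W)
  (f' : Hom X' Y') (h' : Hom X' V') (k' : Hom Y' W') (g' : Hom V' W')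
  (x : Hom X' X) (y : Hom Y' Y) (v : Hom V' V) (w : Hom W' W) :
  is_pullback f h k g -> is_iso x -> is_iso y -> is_iso v -> is_iso w ->
  y ∘ f' = f ∘ x -> v ∘ h' = h ∘ x -> w ∘ k' = k ∘ y -> w ∘ g' = g ∘ v ->
  is_pullback f' h' k' g'.
Proof.
  intros P (x1 & X1 & X2) (y1 & Y1 & Y2) (v1 & V1 & V2) (w1 & W1 & W2) Hf Hh Hk Hg.
  assert (M : forall (a b a' b' : C) (s : Hom a b) (s' : Hom a' b')
    (i : Hom a' a) (i1 : Hom a a') (j : Hom b' b) (j1 : Hom b b'),
    i ∘ i1 = idm _ -> j1 ∘ j = idm _ -> j ∘ s' = s ∘ i -> s' ∘ i1 = j1 ∘ s).
  { intros a b a' b' s s' i i1 j j1 H1 H2 H.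
    now rewrite <- (comp_idl (s' ∘ i1)), <- H2, <- comp_assoc, (comp_assoc j), H,
      <- comp_assoc, H1, comp_idr. }
  refine (@pullback_iso C X Y V W X' Y' V' W' f h k g f' h' k' g' x1 y1 v1 w1
    P _ _ _ _ _ _ _ _); try (eexists; split; eassumption);
  eapply M; eassumption.
Qed.

Lemma pullback_uniq (C : Category) (X Y V W Z : C) (f : Hom X Y) (h : Hom X V)
  (k : Hom Y W) (g : Hom V W) (s s' : Hom Z X) :
  is_pullback f h k g -> f ∘ s = f ∘ s' -> h ∘ s = h ∘ s' -> s = s'.
Proof.
  intros [Hc U] H1 H2; destruct (U Z (f ∘ s) (h ∘ s)) as (t & _ & U').
  { now rewrite !comp_assoc, Hc. }
  rewrite <- (U' s), <- (U' s'); auto.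
Qed.

(** * Binary products and pullbacks as finite limits *)

Section FiniteLimits.

(** Arrows are proofs of a boolean equation: proof irrelevance gives the category laws, and a case
    split on the boolean gives finiteness of the hom-sets. *)
Definition preorder_cat (T : Type) (le : T -> T -> bool)
  (refl : forall a, le a a = true)
  (trans : forall a b c, le b c = true -> le a b = true -> le a c = true) : Category.
Proof.
  refine {| Ob := T; Hom := fun a b => le a b = true;
            idm := refl; comp := trans |}; intros; apply proof_irrelevance.
Defined.

Lemma preorder_cat_finite (T : Type) (le : T -> T -> bool) refl trans :
  finite_type T -> finite_category (@preorder_cat T le refl trans).
Proof.
  intros HT; split; [exact HT|]; intros a b; unfold finite_type; cbn.
  destruct (le a b).
  - exists (eq_refl :: nil); intros x; left; apply proof_irrelevance.
  - exists nil; intros x; discriminate.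
Qed.

Variable C : Category.
Hypothesis Hlim : has_finite_limits C.

Definition discrete_pair : Category.
Proof.
  refine (@preorder_cat bool Bool.eqb Bool.eqb_reflx _).
  intros [] [] []; cbn; congruence.
Defined.

Definition pair_diagram (X Y : C) : Functor discrete_pair C.
Proof.
  refine {| fob := (fun b => if b then X else Y) : discrete_pair -> C;
            fmap := fun a b =>
              match a, b return Bool.eqb a b = true ->
                Hom (if a then X else Y) (if b then X else Y) with
              | true, true => fun _ => idm X
              | false, false => fun _ => idm Y
              | true, false | false, true => fun e => False_rect _ (Bool.diff_false_true e)
              end |}.
  - intros []; reflexivity.
  - intros [] [] [] g f; try discriminate; symmetry; apply comp_idl.
Defined.

Lemma binary_products (X Y : C) :
  exists (P : C) (p1 : Hom P X) (p2 : Hom P Y),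
    forall Z (a : Hom Z X) (b : Hom Z Y), exists! t : Hom Z P, p1 ∘ t = a /\ p2 ∘ t = b.
Proof.
  destruct (@Hlim discrete_pair (pair_diagram X Y)) as (P & leg & _ & U).
  { apply preorder_cat_finite; exists (true :: false :: nil); intros []; cbn; auto. }
  exists P, (leg true), (leg false); intros Z a b.
  destruct (U Z (fun j => match j return Hom Z (if j then X else Y) with
                          | true => a | false => b end)) as (t & Ht & Ut).
  { intros [] [] e; try discriminate; apply comp_idl. }
  exists t; split; [exact (conj (Ht true) (Ht false))|].
  intros t' [H1 H2]; apply Ut; intros []; assumption.
Qed.

(** The shape of a cospan as a preorder: [None] is the common target, hence the top element, and the
    two [Some] values are incomparable. *)
Definition cospan_le (a b : option bool) : bool :=
  match b, a with
  | None, _ => true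
  | Some y, Some x => Bool.eqb x y
  | Some _, None => false
  end.

Definition cospan : Category.
Proof.
  refine (@preorder_cat (option bool) cospan_le _ _).
  - intros [[]|]; reflexivity.
  - intros [[]|] [[]|] [[]|]; cbn; congruence.
Defined.

Section Cospan.
Variables (X Y W : C) (f : Hom X W) (g : Hom Y W).

Definition cospan_ob (a : option bool) : C :=
  match a with Some true => X | Some false => Y | None => W end.

Definition cospan_diagram : Functor cospan C.
Proof.
  refine {| fob := cospan_ob : cospan -> C;
            fmap := fun a b =>
              match a, b return cospan_le a b = true ->
                Hom (cospan_ob a) (cospan_ob b) with
              | Some true, Some true => fun _ => idm X
              | Some false, Some false => fun _ => idm Y
              | None, None => fun _ => idm W
              | Some true, None => fun _ => f
              | Some false, None => fun _ => g
              | Some true, Some false | Some false, Some true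
              | None, Some _ => fun e => False_rect _ (Bool.diff_false_true e)
              end |}.
  - intros [[]|]; reflexivity.
  - intros [[]|] [[]|] [[]|] e1 e2; try discriminate;
      cbn; rewrite ?comp_idl, ?comp_idr; reflexivity.
Defined.

Lemma pullbacks_exist :
  exists (P : C) (a : Hom P X) (b : Hom P Y), is_pullback a b f g.
Proof.
  destruct (@Hlim cospan cospan_diagram) as (P & leg & Hc & U).
  { apply preorder_cat_finite.
    exists (Some true :: Some false :: None :: nil); intros [[]|]; cbn; auto. }
  pose proof (Hc (Some true) None eq_refl) as H1.
  pose proof (Hc (Some false) None eq_refl) as H2; cbn in H1, H2.
  exists P, (leg (Some true)), (leg (Some false)); split.
  - exact (eq_trans H1 (eq_sym H2)).
  - intros Z a b Hab.
    destruct (U Z (fun j => match j return Hom Z (cospan_ob j) with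
                            | Some true => a | Some false => b | None => f ∘ a end))
      as (t & Ht & Ut).
    { intros [[]|] [[]|] e; try discriminate; cbn; rewrite ?comp_idl; auto. }
    exists t; split; [exact (conj (Ht (Some true)) (Ht (Some false)))|].
    intros t' [T1 T2]; apply Ut; intros [[]|]; cbn; [assumption..|].
    now rewrite <- H1, <- comp_assoc, T1.
Qed.

End Cospan.
End FiniteLimits.

(** * Cartesian maps *)

Section CartesianMaps.
Variables (D B : Category) (q : Functor D B).

Lemma over_fmap (X Y : D) (f : Hom X Y) : over q f (fmap q f).
Proof. constructor. Qed.

Lemma over_unique (X Y : D) (f : Hom X Y) (I J : B) (u v : Hom I J) :
  over q f u -> over q f v -> u = v.
Proof. intros H1 H2; exact (hom_eq_eq (hom_eq_trans (hom_eq_sym H1) H2)). Qed.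

Lemma over_eq_fmap (X Y : D) (f g : Hom X Y) (I J : B) (u : Hom I J) :
  over q f u -> over q g u -> fmap q f = fmap q g.
Proof. intros H1 H2; exact (hom_eq_eq (hom_eq_trans H1 (hom_eq_sym H2))). Qed.

Lemma over_between (X Y : D) (f : Hom X Y) (I J : B) :
  q X = I -> q Y = J -> exists u : Hom I J, over q f u.
Proof. intros [] []; exists (fmap q f); constructor. Qed.

Lemma over_src_id (X Y : D) (f : Hom X Y) (I J : B) (u : Hom I J) :
  over q f u -> over q (idm X) (idm I).
Proof. intros H; exact (over_id (over_src H)). Qed.

Lemma vertical_iso (X Y : D) (f : Hom X Y) : vertical q f -> is_iso (fmap q f).
Proof. intros [I H]; exact (hom_eq_id_iso H). Qed.

Lemma over_idm_vertical (X Y : D) (f : Hom X Y) (I : B) :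
  over q f (idm I) -> vertical q f.
Proof. intros H; now exists I. Qed.

Lemma over_idm_iso (X Y : D) (f : Hom X Y) (I : B) :
  over q f (idm I) -> is_iso (fmap q f).
Proof. exact (@hom_eq_id_iso _ _ _ _ _). Qed.

Lemma over_comp_vertical (X Y Z : D) (f : Hom X Y) (g : Hom Y Z) (I J : B)
  (u : Hom I J) : over q f u -> over q g (idm J) -> over q (g ∘ f) u.
Proof. intros H1 H2; rewrite <- (comp_idl u); exact (over_comp H1 H2). Qed.

Lemma over_vertical_comp (X Y Z : D) (f : Hom X Y) (g : Hom Y Z) (I J : B)
  (u : Hom I J) : over q f (idm I) -> over q g u -> over q (g ∘ f) u.
Proof. intros H1 H2; rewrite <- (comp_idr u); exact (over_comp H1 H2). Qed.

Lemma over_cancel_vertical (X Y Z : D) (f : Hom X Y) (g : Hom Y Z) (I J : B)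
  (u : Hom I J) : over q f (idm I) -> over q (g ∘ f) u -> over q g u.
Proof.
  intros Hf Hgf; unfold over in *; rewrite fmap_comp in Hgf.
  exact (hom_eq_trans (hom_eq_sym (hom_eq_cancelr _ Hf)) Hgf).
Qed.

Lemma cartesian_uniq (X Y Z : D) (f : Hom X Y) (h h' : Hom Z X) :
  cartesian q f -> fmap q h = fmap q h' -> f ∘ h = f ∘ h' -> h = h'.
Proof.
  intros Cf H1 H2.
  destruct (Cf Z (f ∘ h) (fmap q h) (eq_sym (fmap_comp q f h))) as (k & _ & U).
  rewrite <- (U h), <- (U h'); auto.
Qed.

Lemma cartesian_uniq_over (X Y Z : D) (f : Hom X Y) (h h' : Hom Z X)
  (I J : B) (w : Hom I J) :
  cartesian q f -> over q h w -> over q h' w -> f ∘ h = f ∘ h' -> h = h'.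
Proof. intros Cf H1 H2; exact (cartesian_uniq Cf (over_eq_fmap H1 H2)). Qed.

Lemma cartesian_comp (X Y Z : D) (f : Hom X Y) (g : Hom Y Z) :
  cartesian q f -> cartesian q g -> cartesian q (g ∘ f).
Proof.
  intros Cf Cg W h w Hw; rewrite fmap_comp, <- comp_assoc in Hw.
  destruct (Cg W h _ Hw) as (h1 & (P1 & E1) & _).
  destruct (Cf W h1 w (eq_sym P1)) as (h2 & (P2 & E2) & _).
  exists h2; split; [split|].
  - exact P2.
  - now rewrite <- comp_assoc, E2.
  - intros h' [P' E']; apply (cartesian_uniq Cf); [now rewrite P2|].
    apply (cartesian_uniq Cg).
    + now rewrite !fmap_comp, P2, P'.
    + now rewrite E2, E1, comp_assoc.
Qed.

Lemma cartesian_cancel (X Y Z : D) (f : Hom X Y) (g : Hom Y Z) :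
  cartesian q g -> cartesian q (g ∘ f) -> cartesian q f.
Proof.
  intros Cg Cgf W h w Hw.
  destruct (Cgf W (g ∘ h) w) as (t & (P1 & E1) & U).
  { now rewrite !fmap_comp, <- comp_assoc, Hw. }
  exists t; split; [split|].
  - exact P1.
  - apply (cartesian_uniq Cg); [now rewrite fmap_comp, P1|].
    now rewrite <- E1, comp_assoc.
  - intros t' [P' E']; apply U; split; [exact P'|].
    now rewrite <- comp_assoc, E'.
Qed.

Lemma iso_cartesian (X Y : D) (f : Hom X Y) : is_iso f -> cartesian q f.
Proof.
  intros (g & G1 & G2) W h w Hw; exists (g ∘ h); split; [split|].
  - rewrite fmap_comp, <- Hw, comp_assoc, <- fmap_comp, G2, fmap_id; apply comp_idl.
  - now rewrite comp_assoc, G1, comp_idl.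
  - intros h' [_ <-]; now rewrite comp_assoc, G2, comp_idl.
Qed.

Lemma cartesian_iso (X Y : D) (f : Hom X Y) :
  cartesian q f -> is_iso (fmap q f) -> is_iso f.
Proof.
  intros Cf (w & W1 & W2).
  destruct (Cf Y (idm Y) w) as (g & (P1 & E1) & _).
  { now rewrite W1, fmap_id. }
  exists g; split; [exact E1|].
  apply (cartesian_uniq Cf).
  - now rewrite fmap_comp, P1, W2, fmap_id.
  - now rewrite comp_assoc, E1, comp_idl, comp_idr.
Qed.

(** This is how statements about the chosen lifts of a cleavage are transferred to arbitrary
    cartesian maps and back. *)
Lemma cartesian_compare (X X' Y : D) (f : Hom X Y) (f' : Hom X' Y) (I J : B)
  (u : Hom J I) :
  over q f u -> cartesian q f -> over q f' u -> cartesian q f' ->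
  exists i : Hom X X', is_iso i /\ over q i (idm J) /\ f' ∘ i = f.
Proof.
  intros Of Cf Of' Cf'.
  destruct (cartesian_over Of' Cf' (w := idm J) (g := f)) as (i & (Oi & Ei) & _).
  { now rewrite comp_idr. }
  exists i; split; [|now split].
  apply cartesian_iso.
  - apply (cartesian_cancel Cf'); now rewrite Ei.
  - exact (over_idm_iso Oi).
Qed.

(** Both sides agree by conversion; the right one hides the opposite categories behind the
    definition of [opcartesian]. *)
Lemma opcartesian_iff (X Y : D) (f : Hom X Y) :
  opcartesian q f <->
  forall Z (g : Hom X Z) (w : Hom (q Y) (q Z)), w ∘ fmap q f = fmap q g ->
    exists! h : Hom Y Z, fmap q h = w /\ h ∘ f = g.
Proof. split; intros H; exact H. Qed.

Lemma opcartesian_over (X Y Z : D) (f : Hom X Y) (g : Hom X Z)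
  (I J K : B) (u : Hom I J) (w : Hom J K) :
  over q f u -> opcartesian q f -> over q g (w ∘ u) ->
  exists h : Hom Y Z, over q h w /\ h ∘ f = g.
Proof.
  intros Of Cf Og.
  destruct (@cartesian_over (op D) (op B) (fop q) Y X f I J u
              (hom_eq_op Of) Cf Z K w g (hom_eq_op Og)) as (h & (Oh & Eh) & _).
  exists h; split; [exact (hom_eq_of_op Oh) | exact Eh].
Qed.

Lemma opcartesian_uniq (X Y Z : D) (f : Hom X Y) (h h' : Hom Y Z) :
  opcartesian q f -> fmap q h = fmap q h' -> h ∘ f = h' ∘ f -> h = h'.
Proof.
  intros Cf H1 H2.
  destruct (Cf Z (h ∘ f) (fmap q h) (eq_sym (fmap_comp q h f))) as (k & _ & U).
  rewrite <- (U h (conj eq_refl eq_refl)).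
  exact (U h' (conj (eq_sym H1) (eq_sym H2))).
Qed.

End CartesianMaps.

(** * Pushouts of vertical maps *)

Section VerticalPushouts.
Variables (E B : Category) (p : Functor E B) (c : Cleavage p).

Definition in_fibre (X : E) (I : B) (H : over p (idm X) (idm I)) : Fibre p I :=
  {| fib_ob := X; fib_eq := over_src H |}.

Definition in_fibre_map (I : B) (X Y : Fibre p I)
  (f : Hom (fib_ob X) (fib_ob Y)) (H : over p f (idm I)) : Hom X Y :=
  {| fib_map := f; fib_over := H |}.

Lemma over_tgt_id (X Y : E) (f : Hom X Y) (I J : B) (u : Hom I J) :
  over p f u -> over p (idm Y) (idm J).
Proof. intros H; exact (over_id (over_tgt H)). Qed.

Lemma cartesian_lift (X : E) (I J : B) (u : Hom J I) :
  over p (idm X) (idm I) ->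
  exists (X' : E) (f : Hom X' X), over p f u /\ cartesian p f /\ over p (idm X') (idm J).
Proof.
  intros H; exists (fib_ob (cl_ob c u (in_fibre H))), (cl_map c u (in_fibre H)).
  split; [apply cl_over | split; [apply cl_cart | apply over_id, fib_eq]].
Qed.

(* A cocone over u : I -> J on vertical maps over I is the same as a cocone in the
   fibre over I with the reindexed vertex. *)
Lemma fibre_pushout_total (I : B) (W Y V X : Fibre p I)
  (k : Hom W Y) (g : Hom W V) (f : Hom Y X) (h : Hom V X) :
  is_pushout k g f h ->
  is_pushout (fib_map k) (fib_map g) (fib_map f) (fib_map h).
Proof.
  intros [Hc U]; split; [exact (f_equal (@fib_map _ _ _ _ _ _) Hc)|].
  intros Z a b Hab.
  assert (Hu : exists u : Hom I (p Z), over p a u).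
  { exact (over_between a (fib_eq Y) eq_refl). }
  destruct Hu as (u & Oa).
  assert (Ob : over p b u).
  { apply (over_cancel_vertical (fib_over g)); rewrite <- Hab.
    exact (over_vertical_comp (fib_over k) Oa). }
  destruct (cartesian_lift (X := Z) u (over_id eq_refl)) as (Z' & z & Oz & Cz & OZ').
  destruct (cartesian_over Oz Cz (w := idm I) (g := a)) as (a' & (Oa' & Ea) & _).
  { now rewrite comp_idr. }
  destruct (cartesian_over Oz Cz (w := idm I) (g := b)) as (b' & (Ob' & Eb) & _).
  { now rewrite comp_idr. }
  destruct (U (in_fibre OZ') (in_fibre_map (Y := in_fibre OZ') Oa')
              (in_fibre_map (Y := in_fibre OZ') Ob')) as (t & [T1 T2] & Ut).
  { apply fibre_hom_eq; cbn; apply (cartesian_uniq_over Cz (w := idm I)).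
    - exact (over_comp_vertical (fib_over k) Oa').
    - exact (over_comp_vertical (fib_over g) Ob').
    - now rewrite !comp_assoc, Ea, Eb. }
  apply (f_equal (@fib_map _ _ _ _ _ _)) in T1, T2; cbn in T1, T2.
  exists (z ∘ fib_map t); split; [split|].
  - now rewrite <- comp_assoc, T1.
  - now rewrite <- comp_assoc, T2.
  - intros t' [H1 H2].
    assert (Ot : over p t' u).
    { apply (over_cancel_vertical (fib_over f)); now rewrite H1. }
    destruct (cartesian_over Oz Cz (w := idm I) (g := t')) as (t1 & (Ot1 & Et) & _).
    { now rewrite comp_idr. }
    rewrite <- Et; f_equal.
    refine (f_equal (@fib_map _ _ _ _ _ _)
              (Ut (in_fibre_map (X := X) (Y := in_fibre OZ') Ot1) _)).
    split; apply fibre_hom_eq; cbn; apply (cartesian_uniq_over Cz (w := idm I));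
      try assumption.
    + exact (over_comp_vertical (fib_over f) Ot1).
    + now rewrite comp_assoc, Et, Ea.
    + exact (over_comp_vertical (fib_over h) Ot1).
    + now rewrite comp_assoc, Et, Eb.
Qed.

(** For a cocone in the fibre the mediating map found in E is automatically vertical, because its
    composite with the vertical [f] is. *)
Lemma total_pushout_fibre (I : B) (W Y V X : Fibre p I)
  (k : Hom W Y) (g : Hom W V) (f : Hom Y X) (h : Hom V X) :
  is_pushout (fib_map k) (fib_map g) (fib_map f) (fib_map h) ->
  is_pushout k g f h.
Proof.
  intros [Hc U]; split; [apply fibre_hom_eq; exact Hc|].
  intros Z a b Hab; apply (f_equal (@fib_map _ _ _ _ _ _)) in Hab; cbn in Hab.
  destruct (U _ _ _ Hab) as (t & [T1 T2] & Ut).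
  assert (Ot : over p t (idm I)).
  { apply (over_cancel_vertical (fib_over f)); rewrite T1; apply fib_over. }
  exists (in_fibre_map Ot); split; [split; apply fibre_hom_eq; assumption|].
  intros t' [H1 H2]; apply fibre_hom_eq; apply Ut.
  split; [now rewrite <- H1 | now rewrite <- H2].
Qed.

Section Cube.
Variables (I J : B) (u : Hom J I).
Variables (W Y V X W' Y' V' X' : E)
  (k : Hom W Y) (g : Hom W V) (f : Hom Y X) (h : Hom V X)
  (k' : Hom W' Y') (g' : Hom W' V') (f' : Hom Y' X') (h' : Hom V' X')
  (w : Hom W' W) (y : Hom Y' Y) (v : Hom V' V) (x : Hom X' X).

(** Preservation is assumed only for the chosen reindexing functors. The unprimed face is read in
    the fibre over [I], reindexed, and read in E again; the primed face is isomorphic to the result,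
    since its edges to the unprimed face are cartesian over the same [u]. *)
Lemma cartesian_pushout :
  preserves_pushouts (reindex c u) ->
  is_pushout k g f h ->
  over p k (idm I) -> over p g (idm I) -> over p f (idm I) -> over p h (idm I) ->
  over p k' (idm J) -> over p g' (idm J) -> over p f' (idm J) -> over p h' (idm J) ->
  over p w u -> over p y u -> over p v u -> over p x u ->
  cartesian p w -> cartesian p y -> cartesian p v -> cartesian p x ->
  y ∘ k' = k ∘ w -> v ∘ g' = g ∘ w -> x ∘ f' = f ∘ y -> x ∘ h' = h ∘ v ->
  is_pushout k' g' f' h'.
Proof.
  intros Hpres P Ok Og Of Oh Ok' Og' Of' Oh' Ow Oy Ov Ox Cw Cy Cv Cx Ek Eg Ef Eh.
  pose (FW := in_fibre (over_src_id Ok)); pose (FY := in_fibre (over_src_id Of)).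
  pose (FV := in_fibre (over_src_id Oh)); pose (FX := in_fibre (over_tgt_id Of)).
  pose (Fk := in_fibre_map (X := FW) (Y := FY) Ok).
  pose (Fg := in_fibre_map (X := FW) (Y := FV) Og).
  pose (Ff := in_fibre_map (X := FY) (Y := FX) Of).
  pose (Fh := in_fibre_map (X := FV) (Y := FX) Oh).
  assert (P1 : is_pushout Fk Fg Ff Fh) by (apply total_pushout_fibre; exact P).
  apply Hpres in P1; apply fibre_pushout_total in P1.
  destruct (cartesian_compare Ow Cw (cl_over c u FW) (cl_cart c u FW))
    as (iw & Iw & Oiw & Eiw).
  destruct (cartesian_compare Oy Cy (cl_over c u FY) (cl_cart c u FY))
    as (iy & Iy & Oiy & Eiy).
  destruct (cartesian_compare Ov Cv (cl_over c u FV) (cl_cart c u FV))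
    as (iv & Iv & Oiv & Eiv).
  destruct (cartesian_compare Ox Cx (cl_over c u FX) (cl_cart c u FX))
    as (ix & Ix & Oix & Eix).
  (* Naturality of the comparison isomorphisms, proved once for all four sides of the face. *)
  assert (M : forall (S T : Fibre p I) (a : Hom S T) (S' T' : E) (a' : Hom S' T')
    (is : Hom S' (fib_ob (cl_ob c u S))) (it : Hom T' (fib_ob (cl_ob c u T)))
    (s : Hom S' (fib_ob S)) (t : Hom T' (fib_ob T)),
    over p is (idm J) -> over p it (idm J) -> over p a' (idm J) ->
    cl_map c u S ∘ is = s -> cl_map c u T ∘ it = t ->
    t ∘ a' = fib_map a ∘ s ->
    it ∘ a' = fib_map (fmap (reindex c u) a) ∘ is).
  { intros S T a S' T' a' is it s t Ois Oit Oa' <- <- Ea.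
    apply (cartesian_uniq_over (cl_cart c u T) (w := idm J)).
    - exact (over_comp_vertical Oa' Oit).
    - exact (over_comp_vertical Ois (fib_over _)).
    - rewrite comp_assoc, Ea, comp_assoc; symmetry; rewrite comp_assoc.
      f_equal; apply (cl_liftK c (reindex_over c u a)). }
  refine (pushout_iso (w := iw) (y := iy) (v := iv) (x := ix) P1 _ _ _ _ _ _ _ _);
    try assumption.
  - exact (M _ _ Fk _ _ _ _ _ _ _ Oiw Oiy Ok' Eiw Eiy Ek).
  - exact (M _ _ Fg _ _ _ _ _ _ _ Oiw Oiv Og' Eiw Eiv Eg).
  - exact (M _ _ Ff _ _ _ _ _ _ _ Oiy Oix Of' Eiy Eix Ef).
  - exact (M _ _ Fh _ _ _ _ _ _ _ Oiv Oix Oh' Eiv Eix Eh).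
Qed.
End Cube.

(** Opcartesianness of [k2] produces the mediating map from its restriction [a], and opcartesianness
    of [k1] shows that it also restricts to [b]. *)
Lemma pushforward_pushout (A A' C C' : E) (m : Hom A C) (k1 : Hom A A')
  (k2 : Hom C C') (m' : Hom A' C') :
  vertical p m -> vertical p m' -> opcartesian p k1 -> opcartesian p k2 ->
  k2 ∘ m = m' ∘ k1 -> is_pushout m k1 k2 m'.
Proof.
  intros Vm Vm' O1 O2 Hc; split; [exact Hc|]; intros Z a b Hab.
  destruct (vertical_iso Vm) as (mi & M1 & M2).
  destruct (vertical_iso Vm') as (ni & N1 & N2).
  (* The property of [k2] asks for a base arrow out of [p C']; it is that of [b], moved along the
     invertible image of [m']. *)
  assert (H : (fmap p b ∘ ni) ∘ fmap p k2 = fmap p a).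
  { rewrite <- (comp_idr (_ ∘ fmap p k2)), <- M1, !comp_assoc.
    rewrite <- (comp_assoc _ (fmap p k2) (fmap p m)), <- fmap_comp, Hc, fmap_comp.
    rewrite <- (comp_assoc (fmap p b)), (comp_assoc ni), N2, comp_idl.
    now rewrite <- fmap_comp, <- Hab, fmap_comp, <- comp_assoc, M1, comp_idr. }
  destruct (O2 Z a _ H) as (t & (P1 & E1) & U); cbn in P1, E1.
  exists t; split; [split|].
  - exact E1.
  - apply (opcartesian_uniq O1).
    + now rewrite fmap_comp, P1, <- comp_assoc, N2, comp_idr.
    + now rewrite <- comp_assoc, <- Hc, comp_assoc, E1.
  - intros t' [H1 H2]; apply U; split; [cbn|exact H1].
    now rewrite <- H2, fmap_comp, <- comp_assoc, N1, comp_idr.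
Qed.

Hypothesis Hop : is_fibration (fop p).

Lemma opcartesian_lift (X : E) (I J : B) (u : Hom I J) :
  over p (idm X) (idm I) ->
  exists (X' : E) (f : Hom X X'), over p f u /\ opcartesian p f.
Proof.
  intros H; pose proof (over_src H) as e; destruct e.
  destruct (Hop (Y := X) u) as (X' & f & Of & Cf).
  exists X', f; split; [exact (hom_eq_of_op Of) | exact Cf].
Qed.

(** [phi] need not be vertical, so [m] and [phi] cannot be pushed out in a fibre directly. After [m]
    is pushed forward along [tau], the remaining span [m'], [v] lies in the fibre over [J]. *)
Lemma pushforward_factorisation (A C X : E) (m : Hom A C) (phi : Hom A X)
  (K J : B) (tau : Hom K J) :
  over p m (idm K) -> over p phi tau ->
  exists (A' C' : E) (k1 : Hom A A') (k2 : Hom C C') (m' : Hom A' C') (v : Hom A' X),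
    opcartesian p k1 /\ opcartesian p k2 /\ over p k1 tau /\ over p k2 tau /\
    over p m' (idm J) /\ over p v (idm J) /\ v ∘ k1 = phi /\
    is_pushout m k1 k2 m'.
Proof.
  intros Om Op.
  destruct (opcartesian_lift tau (over_src_id Om)) as (A' & k1 & O1 & C1).
  destruct (opcartesian_lift tau (over_tgt_id Om)) as (C' & k2 & O2 & C2).
  destruct (opcartesian_over (w := idm J) (g := phi) O1 C1) as (v & Ov & Ev).
  { now rewrite comp_idl. }
  destruct (opcartesian_over (w := idm J) (g := k2 ∘ m) O1 C1) as (m' & Om' & Em).
  { rewrite comp_idl; exact (over_vertical_comp Om O2). }
  exists A', C', k1, k2, m', v; repeat (split; [assumption|]).
  apply pushforward_pushout; try assumption; [now exists K | now exists J | now symmetry].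
Qed.

Lemma opcartesian_dom_pushout (x y : Vert p) (k : Hom x y) :
  opcartesian (domF p) k <->
  is_pushout (arr x) (sq_dom k) (sq_cod k) (arr y).
Proof.
  rewrite opcartesian_iff; split.
  - intros O; split; [symmetry; exact (sq_comm k)|]; intros Z a b Hab.
    (* Identities are vertical, so a cocone with vertex [Z] can be encoded as a square into the
       identity of [Z]; [b] is then the prescribed domain component of the factorisation through
       [y]. *)
    pose (z := {| dom := Z; cod := Z; arr := idm Z;
                  arr_vertical := ex_intro _ (p Z) (over_id eq_refl) |} : Vert p).
    assert (Hz : arr z ∘ (b ∘ sq_dom k) = a ∘ arr x) by (cbn; now rewrite comp_idl).
    destruct (O z (@Build_square _ _ p x z (b ∘ sq_dom k) a Hz) b eq_refl)
      as (t & (T1 & T2) & U).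
    exists (sq_cod t); split; [split|].
    + exact (f_equal (@sq_cod _ _ _ _ _) T2).
    + exact (eq_trans (eq_sym (sq_comm t)) (eq_trans (comp_idl (sq_dom t)) T1)).
    + intros t' [H1 H2].
      assert (Ht : arr z ∘ b = t' ∘ arr y) by (cbn; now rewrite comp_idl).
      refine (f_equal (@sq_cod _ _ _ _ _)
               (U (@Build_square _ _ p y z b t' Ht) (conj eq_refl _))).
      apply square_eq; [reflexivity | exact H1].
  - intros [Hc U] z a w Hw; cbn in Hw.
    destruct (U _ (sq_cod a) (arr z ∘ w)) as (t & [T1 T2] & Ut).
    { rewrite <- comp_assoc, <- sq_comm; f_equal; now symmetry. }
    exists (@Build_square _ _ p y z w t (eq_sym T2)); split; [split|].
    + reflexivity.
    + apply square_eq; [exact Hw | exact T1].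
    + intros t' [H1 H2]; cbn in H1, H2.
      apply square_eq; cbn; [now symmetry | apply Ut; split].
      * exact (f_equal (@sq_cod _ _ _ _ _) H2).
      * rewrite <- sq_comm, H1; reflexivity.
Qed.

Lemma opcartesian_dom_exists (x : Vert p) (X : E) (phi : Hom (dom x) X) :
  (forall I : B, has_pushouts (Fibre p I)) ->
  exists (K : E) (l : Hom X K) (n : Hom (cod x) K),
    vertical p l /\ is_pushout (arr x) phi n l.
Proof.
  intros Hpo.
  assert (Oa : over p (arr x) (idm (p (dom x))))
    by (apply vertical_over; [apply arr_vertical | reflexivity]).
  destruct (pushforward_factorisation Oa (over_fmap p phi))
    as (A' & C' & k1 & k2 & m' & v & _ & _ & _ & _ & Om' & Ov & <- & P1).
  pose (FA := in_fibre (over_src_id Om')).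
  destruct (Hpo _ _ _ _ (in_fibre_map (X := FA) (Y := in_fibre (over_tgt_id Om')) Om')
              (in_fibre_map (X := FA) (Y := in_fibre (over_tgt_id Ov)) Ov))
    as (K & n & l & P2).
  apply fibre_pushout_total in P2.
  exists (fib_ob K), (fib_map l), (fib_map n ∘ k2); split.
  - exists (p X); exact (fib_over l).
  - exact (pushout_paste P1 P2).
Qed.

End VerticalPushouts.

(** * Universal spans *)

Section LevelwiseCartesian.
Variables (E B : Category) (p : Functor E B) (c : Cleavage p).

Lemma arr_over (x : Vert p) : over p (arr x) (idm (p (dom x))).
Proof. apply vertical_over; [apply arr_vertical | reflexivity]. Qed.

Lemma square_iso (x y : Vert p) (a : Hom x y) :
  is_iso a <-> is_iso (sq_dom a) /\ is_iso (sq_cod a).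
Proof.
  split.
  - intros (b & H1 & H2); split; [exists (sq_dom b) | exists (sq_cod b)]; split.
    + exact (f_equal (@sq_dom _ _ _ _ _) H1).
    + exact (f_equal (@sq_dom _ _ _ _ _) H2).
    + exact (f_equal (@sq_cod _ _ _ _ _) H1).
    + exact (f_equal (@sq_cod _ _ _ _ _) H2).
  - intros [(b1 & H1 & H2) (b2 & H3 & H4)].
    assert (Hb : arr x ∘ b1 = b2 ∘ arr y).
    { rewrite <- (comp_idl (arr x ∘ b1)), <- H4, <- comp_assoc.
      now rewrite (comp_assoc (sq_cod a)), <- sq_comm, <- comp_assoc, H1, comp_idr. }
    exists (@Build_square _ _ p y x b1 b2 Hb); split; apply square_eq; assumption.
Qed.

Lemma vert_lift (x : Vert p) (N : B) (u : Hom N (pdom p x)) :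
  exists (M : Vert p) (a : Hom M x),
    pdom p M = N /\ over (pdom p) a u /\ cartesian (pdom p) a /\
    cartesian p (sq_dom a) /\ cartesian p (sq_cod a).
Proof.
  pose (xf := m_fib x).
  exists (fib_ob (vreindex c u xf)), (vreindex_map c u xf).
  split; [exact (fib_eq (vreindex c u xf))|].
  split; [apply vreindex_over|]; split; [apply vreindex_cart|].
  split; apply cl_cart.
Qed.

(** The chosen lift over the same base arrow is cartesian both as a square and levelwise. Any other
    square differs from it by a vertical square, which is invertible exactly when both its
    components are. *)
Lemma cartesian_levels (x y : Vert p) (a : Hom x y) :
  cartesian (pdom p) a <-> cartesian p (sq_dom a) /\ cartesian p (sq_cod a).
Proof.
  destruct (vert_lift (x := y) (fmap (pdom p) a)) as (z & b & _ & Ob & Cb & C1 & C2).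
  pose proof (over_fmap (pdom p) a) as Oa.
  split.
  - intros Ca; destruct (cartesian_compare Oa Ca Ob Cb) as (i & Ii & _ & <-).
    apply square_iso in Ii; destruct Ii as [I1 I2].
    split; cbn; apply cartesian_comp; try assumption; now apply iso_cartesian.
  - intros [A1 A2].
    destruct (cartesian_over Ob Cb (w := idm (pdom p x)) (g := a)) as (i & (Oi & Ei) & _).
    { now rewrite comp_idr. }
    subst a; apply cartesian_comp; [|exact Cb].
    apply iso_cartesian, square_iso; split.
    + apply (cartesian_iso (q := p)); [exact (cartesian_cancel C1 A1)|].
      exact (over_idm_iso (q := p) (f := sq_dom i) Oi).
    + apply (cartesian_iso (q := p)); [exact (cartesian_cancel C2 A2)|].
      exact (over_idm_iso (square_cod_over Oi)).
Qed.

(** The base arrow of the mediating map is forced to be that of [t] followed by the inverse of the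
    image of [arr x]; the cartesian [sq_dom a] then lifts it. *)
Lemma cartesian_square_pullback (x y : Vert p) (a : Hom x y) :
  cartesian p (sq_dom a) -> cartesian p (sq_cod a) ->
  is_pullback (sq_dom a) (arr x) (arr y) (sq_cod a).
Proof.
  intros C1 C2; split; [exact (sq_comm a)|]; intros Z s t Hst.
  destruct (vertical_iso (arr_vertical x)) as (xi & X1 & X2).
  destruct (vertical_iso (arr_vertical y)) as (yi & Y1 & Y2).
  destruct (C1 Z s (xi ∘ fmap p t)) as (r & (P & R) & _).
  { rewrite <- (comp_idl (_ ∘ (_ ∘ _))), <- Y2, <- (comp_assoc yi).
    rewrite (comp_assoc (fmap p (arr y))), <- fmap_comp, sq_comm, fmap_comp.
    rewrite <- (comp_assoc (fmap p (sq_cod a))), (comp_assoc _ xi), X1, comp_idl.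
    now rewrite <- fmap_comp, <- Hst, fmap_comp, comp_assoc, Y2, comp_idl. }
  exists r; split; [split|].
  - exact R.
  - apply (cartesian_uniq C2).
    + now rewrite fmap_comp, P, comp_assoc, X1, comp_idl.
    + now rewrite comp_assoc, <- sq_comm, <- comp_assoc, R.
  - intros r' [R1 R2]; apply (cartesian_uniq C1); [|now rewrite R].
    now rewrite P, <- R2, fmap_comp, comp_assoc, X2, comp_idl.
Qed.

End LevelwiseCartesian.

Section UniversalSpans.
Variables (D B : Category) (q : Functor D B).

(* Representability of D_J (u^*A, v^*X) in (u, v) : J -> I x I', stated without
   reference to a cleavage. *)
Definition universal_span (A X U : D) (al : Hom U A) (e : Hom U X) : Prop :=
  cartesian q al /\
  forall Z (r : Hom Z A) (x : Hom Z X), cartesian q r ->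
    exists! s : Hom Z U, al ∘ s = r /\ e ∘ s = x.

(** The universal property speaks only of spans with cartesian left leg, so cartesianness of
    [al ∘ s] has to be supplied. *)
Lemma universal_span_uniq (A X U : D) (al : Hom U A) (e : Hom U X) Z (s s' : Hom Z U) :
  universal_span al e -> cartesian q (al ∘ s) ->
  al ∘ s = al ∘ s' -> e ∘ s = e ∘ s' -> s = s'.
Proof.
  intros [_ HU] Cs H1 H2; destruct (HU Z (al ∘ s) (e ∘ s) Cs) as (t & _ & U').
  rewrite <- (U' s), <- (U' s'); auto.
Qed.

End UniversalSpans.

(** * Existence of universal spans in E and in V(E) *)

Section UniversalSpanExistence.
Variables (E B : Category) (p : Functor E B) (c : Cleavage p).
Hypothesis Hlim : has_finite_limits B.

Lemma slice_hom_eq (I J H : B) (u : Hom J I) (s : Hom H I) (r r' : slice_hom u s) :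
  proj1_sig r = proj1_sig r' -> r = r'.
Proof.
  destruct r as [r Hr], r' as [r' Hr']; cbn; intros <-.
  f_equal; apply proof_irrelevance.
Qed.

Lemma fibre_lift (X : E) (J : B) (u : Hom J (p X)) :
  exists (X' : Fibre p J) (f : Hom (fib_ob X') X), over p f u /\ cartesian p f.
Proof.
  pose (FX := {| fib_ob := X; fib_eq := eq_refl |} : Fibre p (p X)).
  exists (cl_ob c u FX), (cl_map c u FX); split; [apply cl_over | apply cl_cart].
Qed.

(** Local smallness needs both objects over one base: [A] and [X] are reindexed to the product of
    their bases. The apex is then the reindexing of [A] to the representing object [H]. *)
Lemma universal_span_total (A X : E) :
  locally_small c -> exists U (al : Hom U A) (e : Hom U X), universal_span p al e.
Proof.
  intros Hls.
  destruct (binary_products Hlim (p A) (p X)) as (P & p1 & p2 & HP).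
  destruct (fibre_lift p1) as (X1 & q1 & Oq1 & Cq1).
  destruct (fibre_lift p2) as (Y1 & q2 & Oq2 & Cq2).
  destruct (Hls P X1 Y1) as (H & s & phi & Hphi & Hnat).
  (* The Yoneda argument: the value at the identity of [s] is the universal map, and [Nat] says that
     every [phi J u r] is its restriction along [r]. *)
  pose (g0 := phi H s (exist _ (idm H) (comp_idr s))).
  assert (Nat : forall J (u : Hom J P) (r : slice_hom u s),
    cl_map c s Y1 ∘ fib_map g0 ∘ comparison c (proj2_sig r) X1 =
    cl_map c u Y1 ∘ fib_map (phi J u r)).
  { intros J u r.
    pose proof (Hnat H J s u (exist _ (idm H) (comp_idr s)) r) as N.
    unfold restricts_to in N.
    replace (slice_comp (exist _ (idm H) (comp_idr s)) r) with r in N.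
    - rewrite <- comp_assoc.
      transitivity (cl_map c s Y1 ∘ (comparison c (proj2_sig r) Y1 ∘ fib_map (phi J u r))).
      + apply f_equal; symmetry; exact N.
      + rewrite comp_assoc; apply (f_equal (fun k => k ∘ fib_map (phi J u r))).
        exact (cl_liftK c (comparison_over c (proj2_sig r) Y1)).
    - apply slice_hom_eq; cbn; symmetry; apply comp_idl. }
  pose (al := q1 ∘ cl_map c s X1).
  pose (e := q2 ∘ (cl_map c s Y1 ∘ fib_map g0)).
  assert (Oal : over p al (p1 ∘ s)) by exact (over_comp (cl_over c s X1) Oq1).
  assert (Oe : over p e (p2 ∘ s)).
  { refine (over_comp _ Oq2).
    exact (over_vertical_comp (fib_over g0) (cl_over c s Y1)). }
  exists (fib_ob (cl_ob c s X1)), al, e; split.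
  { apply cartesian_comp; [apply cl_cart | exact Cq1]. }
  intros Z r x Cr.
  destruct (HP _ (fmap p r) (fmap p x)) as (u & [U1 U2] & Uu).
  assert (Ou : over p (q1 ∘ cl_map c u X1) (p1 ∘ u))
    by exact (over_comp (cl_over c u X1) Oq1).
  assert (Or : over p r (p1 ∘ u)) by (rewrite U1; constructor).
  (* [r] is cartesian over the same arrow as the composite lift through [X1]. Along the inverse [j]
     of the comparison, [x] becomes a map that factors through a map in the fibre over [p Z], to
     which representability applies. *)
  destruct (cartesian_compare Or Cr Ou) as (i & (j & IJ & JI) & Oi & Ei).
  { apply cartesian_comp; [apply cl_cart | exact Cq1]. }
  assert (Oj : over p j (idm (p Z))).
  { apply (over_cancel_vertical Oi); rewrite JI; now apply over_id. }
  assert (Oxj : over p (x ∘ j) (p2 ∘ u)).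
  { rewrite U2; exact (over_vertical_comp Oj (over_fmap p x)). }
  destruct (cartesian_over Oq2 Cq2 Oxj) as (h1 & (Oh1 & Eh1) & _).
  destruct (cartesian_over (cl_over c u Y1) (cl_cart c u Y1) (w := idm (p Z)) (g := h1))
    as (h & (Oh & Eh) & _).
  { now rewrite comp_idr. }
  pose (hf := in_fibre_map (X := cl_ob c u X1) (Y := cl_ob c u Y1) Oh).
  destruct (Hphi _ u hf) as (t & Ht & Ut).
  assert (Eht : cl_map c u Y1 ∘ fib_map (phi _ u t) = h1) by (rewrite Ht; exact Eh).
  assert (Al : forall v : slice_hom u s,
    al ∘ comparison c (proj2_sig v) X1 = q1 ∘ cl_map c u X1).
  { intros v; unfold al; rewrite <- comp_assoc; f_equal.
    apply (cl_liftK c (comparison_over c (proj2_sig v) X1)). }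
  exists (comparison c (proj2_sig t) X1 ∘ i); split; [split|].
  - now rewrite comp_assoc, Al.
  - unfold e; rewrite comp_assoc, <- (comp_assoc q2), Nat, Eht.
    now rewrite Eh1, <- comp_assoc, JI, comp_idr.
  - intros z [Z1 Z2].
    destruct (over_between (q := p) (z ∘ j) (I := p Z) (J := H)) as (t0 & Ot0).
    { exact (fib_eq (cl_ob c u X1)). }
    { exact (fib_eq (cl_ob c s X1)). }
    assert (Alz : al ∘ (z ∘ j) = q1 ∘ cl_map c u X1).
    { now rewrite comp_assoc, Z1, <- Ei, <- comp_assoc, IJ, comp_idr. }
    (* An arrow into the product [P] is determined by its projections, here the bases of [r] and
       [x]; the competitor [z] reproduces both, so [t0] is a map in the slice over [P]. *)
    assert (Et0 : s ∘ t0 = u).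
    { symmetry; apply Uu; rewrite !comp_assoc, <- U1, <- U2; split.
      - apply (over_unique (q := p) (f := al ∘ (z ∘ j))); [exact (over_comp Ot0 Oal)|].
        rewrite Alz; exact Ou.
      - apply (over_unique (q := p) (f := e ∘ (z ∘ j))); [exact (over_comp Ot0 Oe)|].
        rewrite comp_assoc, Z2; exact Oxj. }
    pose (r0 := exist _ t0 Et0 : slice_hom u s).
    assert (Ez : z ∘ j = comparison c (proj2_sig r0) X1).
    { apply cl_lift_uniq; [exact Ot0|].
      apply (cartesian_uniq_over Cq1 (w := u)).
      - rewrite <- Et0; exact (over_comp Ot0 (cl_over c s X1)).
      - apply cl_over.
      - rewrite comp_assoc; exact Alz. }
    rewrite (Ut r0), <- Ez, <- comp_assoc, JI, comp_idr; [reflexivity|].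
    apply fibre_hom_eq; apply (cartesian_uniq_over (cl_cart c u Y1) (w := idm (p Z)));
      [apply fib_over | exact Oh |].
    apply (cartesian_uniq_over Cq2 (w := u)).
    + exact (over_vertical_comp (fib_over (phi _ u r0)) (cl_over c u Y1)).
    + exact (over_vertical_comp Oh (cl_over c u Y1)).
    + transitivity (e ∘ (z ∘ j)).
      * rewrite Ez; unfold e; rewrite <- (comp_assoc q2), Nat; reflexivity.
      * rewrite comp_assoc, Z2, <- Eh1, <- Eh; reflexivity.
Qed.

Lemma universal_span_vert (x y : Vert p) :
  locally_small c ->
  exists U (al : Hom U x) (e : Hom U y), universal_span (pdom p) al e.
Proof.
  intros Hls.
  destruct (universal_span_total (dom x) (dom y) Hls) as (H1 & al1 & e1 & U1).
  destruct (universal_span_total (cod x) (cod y) Hls) as (H2 & al2 & e2 & U2).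
  destruct (universal_span_total (dom x) (cod y) Hls) as (H3 & al3 & e3 & U3).
  pose proof U1 as [C1 X1]; pose proof U2 as [C2 X2]; pose proof U3 as [C3 X3].
  (* Postcomposition with [arr y] is [f1 : H1 -> H3].  Precomposition with [arr x] needs
     [dom x] restricted along [al2], and is then [f2 : A2 -> H3].  [N] is the object of
     commuting squares. *)
  destruct (over_between (q := p) al2 (I := p H2) (J := p (dom x)) eq_refl
    (over_tgt (arr_over x))) as (w2 & Ow2).
  destruct (cartesian_lift c w2 (over_src_id (arr_over x)))
    as (A2 & q2 & Oq2 & Cq2 & OA2).
  destruct (cartesian_over Ow2 C2 (w := idm (p H2)) (g := arr x ∘ q2))
    as (m2 & (Om2 & Em2) & _).
  { rewrite comp_idr; exact (over_comp_vertical Oq2 (arr_over x)). }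
  pose (x2 := {| dom := A2; cod := H2; arr := m2; arr_vertical := over_idm_vertical Om2 |}
    : Vert p).
  pose (sq2 := @Build_square _ _ p x2 x q2 al2 (eq_sym Em2)).
  pose proof (cartesian_square_pullback (a := sq2 : Hom x2 x) Cq2 C2) as PB2.
  cbn in PB2; pose proof PB2 as [_ X4].
  destruct (X3 _ al1 (arr y ∘ e1) C1) as (f1 & [F1 F1'] & _).
  destruct (X3 _ q2 (e2 ∘ m2) Cq2) as (f2 & [F2 F2'] & _).
  destruct (pullbacks_exist Hlim (fmap p f1) (fmap p f2)) as (N & n1 & n2 & PN).
  pose proof PN as [CN XN].
  (* The apex [M] is [x] reindexed to [N]. Below, [a1] and [b2] yield the two components of the
     universal square, while [a2] lies over the second projection of the pullback. *)
  destruct (vert_lift c (x := x) (fmap p al1 ∘ n1)) as (M & al & eM & Oal & Cal & D1 & D2).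
  change (p (dom M) = N) in eM; destruct eM; apply hom_eq_eq in Oal; cbn in Oal.
  destruct (C1 _ (sq_dom al) n1 (eq_sym Oal)) as (a1 & (A1p & A1) & _).
  destruct (Cq2 _ (sq_dom al) n2) as (a2 & (A2p & A2') & _).
  { rewrite Oal, <- F2, <- F1, !fmap_comp, <- !comp_assoc; now f_equal. }
  destruct (vertical_iso (arr_vertical M)) as (Mi & M1 & M2).
  destruct (C2 _ (sq_cod al) (fmap p m2 ∘ n2 ∘ Mi)) as (b2 & (B2p & B2) & _).
  { rewrite !comp_assoc, <- fmap_comp, Em2, fmap_comp, <- A2p.
    rewrite <- (comp_assoc (fmap p (arr x))), <- (fmap_comp p q2), A2'.
    now rewrite <- fmap_comp, sq_comm, fmap_comp, <- comp_assoc, M1, comp_idr. }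
  assert (Eb : m2 ∘ a2 = b2 ∘ arr M).
  { apply (cartesian_uniq C2).
    - now rewrite !fmap_comp, B2p, A2p, <- !comp_assoc, M2, comp_idr.
    - now rewrite !comp_assoc, Em2, B2, <- comp_assoc, A2', sq_comm. }
  assert (Ef : f1 ∘ a1 = f2 ∘ a2).
  { apply (cartesian_uniq C3).
    - rewrite !fmap_comp, A1p, A2p; exact CN.
    - now rewrite !comp_assoc, F1, F2, A1, A2'. }
  assert (He : arr y ∘ (e1 ∘ a1) = (e2 ∘ b2) ∘ arr M).
  { now rewrite comp_assoc, <- F1', <- comp_assoc, Ef, comp_assoc, F2', <- !comp_assoc, Eb. }
  pose (e := @Build_square _ _ p M y (e1 ∘ a1) (e2 ∘ b2) He).
  exists M, al, e; split; [exact Cal|].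
  intros Z r xi Cr; pose proof Cr as Cr'.
  apply (cartesian_levels c) in Cr'; destruct Cr' as [R1 R2].
  destruct (X1 _ (sq_dom r) (sq_dom xi) R1) as (z1 & [Z1 Z1'] & _).
  destruct (X2 _ (sq_cod r) (sq_cod xi) R2) as (z2 & [Z2 Z2'] & _).
  destruct (X4 _ (sq_dom r) (z2 ∘ arr Z)) as (z3 & [Z3 Z3'] & _).
  { now rewrite sq_comm, comp_assoc, Z2. }
  assert (Ez : f1 ∘ z1 = f2 ∘ z3).
  { apply (universal_span_uniq U3).
    - now rewrite comp_assoc, F1, Z1.
    - now rewrite !comp_assoc, F1, F2, Z1, Z3.
    - rewrite !comp_assoc, F1', F2', <- !comp_assoc, Z1', Z3'.
      now rewrite comp_assoc, Z2', sq_comm. }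
  destruct (XN _ (fmap p z1) (fmap p z3)) as (w & [W1 W2] & _).
  { now rewrite <- !fmap_comp, Ez. }
  destruct (Cal _ r w) as (s & (Sp & Es) & _).
  { cbn; now rewrite Oal, <- comp_assoc, W1, <- fmap_comp, Z1. }
  cbn in Sp.
  pose proof (f_equal (@sq_dom _ _ _ _ _) Es) as Es1.
  pose proof (f_equal (@sq_cod _ _ _ _ _) Es) as Es2; cbn in Es1, Es2.
  destruct (vertical_iso (arr_vertical Z)) as (Zi & Zi1 & Zi2).
  exists s; split; [split|].
  - exact Es.
  - apply square_eq; cbn; rewrite <- comp_assoc.
    + rewrite <- Z1'; f_equal; apply (cartesian_uniq C1).
      * now rewrite fmap_comp, A1p, Sp, W1.
      * now rewrite comp_assoc, A1, Es1, Z1.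
    + rewrite <- Z2'; f_equal; apply (cartesian_uniq C2).
      * rewrite <- (comp_idr (fmap p (_ ∘ _))), <- (comp_idr (fmap p z2)), <- Zi1.
        rewrite !comp_assoc, <- !fmap_comp, <- Z3', <- comp_assoc, <- sq_comm.
        now rewrite comp_assoc, <- Eb, !fmap_comp, A2p, Sp, <- (comp_assoc _ n2), W2.
      * now rewrite comp_assoc, B2, Es2, Z2.
  - intros s' [Es' Ee'].
    pose proof (f_equal (@sq_dom _ _ _ _ _) Es') as E1.
    pose proof (f_equal (@sq_cod _ _ _ _ _) Es') as E2.
    pose proof (f_equal (@sq_dom _ _ _ _ _) Ee') as E3.
    pose proof (f_equal (@sq_cod _ _ _ _ _) Ee') as E4.
    cbn in E1, E2, E3, E4; rewrite <- comp_assoc in E3, E4.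
    assert (Y1 : a1 ∘ sq_dom s' = z1).
    { symmetry; apply (universal_span_uniq U1).
      - now rewrite Z1.
      - now rewrite comp_assoc, A1, E1, Z1.
      - now rewrite E3. }
    assert (Y2 : b2 ∘ sq_cod s' = z2).
    { symmetry; apply (universal_span_uniq U2).
      - now rewrite Z2.
      - now rewrite comp_assoc, B2, E2, Z2.
      - now rewrite E4. }
    assert (Y3 : a2 ∘ sq_dom s' = z3).
    { apply (pullback_uniq PB2).
      - now rewrite comp_assoc, A2', E1, Z3.
      - now rewrite Z3', comp_assoc, Eb, <- comp_assoc, sq_comm, comp_assoc, Y2. }
    apply (cartesian_uniq Cal); [cbn | now rewrite Es].
    rewrite Sp; apply (pullback_uniq PN).
    + now rewrite W1, <- A1p, <- fmap_comp, Y1.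
    + now rewrite W2, <- A2p, <- fmap_comp, Y3.
Qed.

End UniversalSpanExistence.

(** * Universal lifting problems as universal spans *)

Section LiftingProblems.
Variables (E B : Category) (p : Functor E B) (c : Cleavage p) (m : Vert p).

Lemma universal_span_iso (D : Category) (q : Functor D B) (A X U U' : D)
  (al : Hom U A) (e : Hom U X) (i : Hom U' U) :
  universal_span q al e -> is_iso i -> universal_span q (al ∘ i) (e ∘ i).
Proof.
  intros HU Ii; pose proof HU as [C Hs]; pose proof Ii as (j & J1 & J2); split.
  - apply cartesian_comp; [now apply iso_cartesian | exact C].
  - intros Z r x Cr; destruct (Hs Z r x Cr) as (s & [S1 S2] & Us).
    exists (j ∘ s); split; [split|].
    + now rewrite comp_assoc, <- (comp_assoc al), J1, comp_idr.
    + now rewrite comp_assoc, <- (comp_assoc e), J1, comp_idr.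
    + intros s' [H1 H2]; rewrite (Us (i ∘ s')).
      * now rewrite comp_assoc, J2, comp_idl.
      * now rewrite !comp_assoc.
Qed.

Definition pull_comparison (K H : B) (s : Hom H (pdom p m)) (t : Hom K H)
  (u : Hom K (pdom p m)) (e : s ∘ t = u) : Hom (pull c u) (pull c s) :=
  comparison (vcleavage c) e (m_fib m).

Lemma comparison_over_slice (K H : B) (s : Hom H (pdom p m)) (t : Hom K H)
  (u : Hom K (pdom p m)) (e : s ∘ t = u) :
  over (pdom p) (pull_comparison e) t.
Proof. apply cl_lift_over. Qed.

Lemma comparison_map (K H : B) (s : Hom H (pdom p m)) (t : Hom K H)
  (u : Hom K (pdom p m)) (e : s ∘ t = u) :
  pull_map c s ∘ pull_comparison e = pull_map c u.
Proof. apply (cl_liftK (vcleavage c) (comparison_over (vcleavage c) e (m_fib m))). Qed.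

Lemma comparison_unique (K H : B) (s : Hom H (pdom p m)) (t : Hom K H)
  (u : Hom K (pdom p m)) (e : s ∘ t = u) (a : Hom (pull c u) (pull c s)) :
  over (pdom p) a t -> pull_map c s ∘ a = pull_map c u ->
  a = pull_comparison e.
Proof. intros H1 H2; now apply cl_lift_uniq. Qed.

Lemma pull_base (K : B) (s : Hom K (pdom p m)) : pdom p (pull c s) = K.
Proof. apply fib_eq. Qed.

Lemma pull_map_over (K : B) (s : Hom K (pdom p m)) : over (pdom p) (pull_map c s) s.
Proof. exact (cl_over (vcleavage c) s (m_fib m)). Qed.

Lemma pull_map_cartesian (K : B) (s : Hom K (pdom p m)) :
  cartesian (pdom p) (pull_map c s).
Proof. exact (cl_cart (vcleavage c) s (m_fib m)). Qed.

(** The left leg is first replaced by the chosen lift over its own base arrow. Maps between chosen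
    reindexings of [m] that commute with the maps to [m] are then the canonical comparisons, so they
    amount to base arrows. *)
Lemma lifting_problem_of_span (f U : Vert p) (al : Hom U m) (e : Hom U f) :
  universal_span (pdom p) al e -> inhabited (universal_lifting_problem c m f).
Proof.
  intros HU; pose proof HU as [Cal _].
  pose (s := fmap (pdom p) al); pose proof (over_fmap (pdom p) al) as Oal.
  destruct (cartesian_compare (pull_map_over s) (@pull_map_cartesian _ s) Oal Cal)
    as (i & Ii & Oi & Ei).
  pose proof (universal_span_iso HU Ii) as HU'; rewrite Ei in HU'; destruct HU' as [_ HU'].
  assert (Oe : over (pdom p) (e ∘ i) (fmap (pdom p) e))
    by exact (over_vertical_comp Oi (over_fmap _ e)).
  refine (inhabits (@Build_universal_lifting_problem _ _ p c m f (pdom p U) s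
    (fmap (pdom p) e) (e ∘ i) Oe _)).
  intros K sg tau h Oh.
  destruct (HU' _ (pull_map c sg) h (@pull_map_cartesian _ sg)) as (a & [A1 A2] & Ua).
  destruct (over_between (q := pdom p) a (pull_base sg) (pull_base s)) as (t & Ot).
  assert (Et : s ∘ t = sg).
  { apply (over_unique (q := pdom p) (f := pull_map c s ∘ a)).
    - exact (over_comp Ot (pull_map_over s)).
    - rewrite A1; apply pull_map_over. }
  exists t; split.
  - exists Et; split.
    + apply (over_unique (q := pdom p) (f := (e ∘ i) ∘ a)).
      * exact (over_comp Ot Oe).
      * now rewrite A2.
    + change (h = e ∘ i ∘ pull_comparison Et); now rewrite <- (comparison_unique Et Ot A1).
  - intros t' (Et' & _ & Eh).
    apply (over_unique (q := pdom p) (f := a)); [exact Ot|].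
    rewrite (Ua _ (conj (comparison_map Et') (eq_sym Eh))).
    apply comparison_over_slice.
Qed.

(** The record tests only against chosen reindexings of [m]; an arbitrary cartesian [r] differs from
    one by the isomorphism [i]. In this form the comonad laws need no bookkeeping of base arrows. *)
Lemma span_of_lifting_problem (f : Vert p) (L : universal_lifting_problem c m f) :
  universal_span (pdom p) (pull_map c (lp_sigma L)) (lp_map L).
Proof.
  split; [apply pull_map_cartesian|]; intros Z r x Cr.
  pose (sg := fmap (pdom p) r); pose proof (over_fmap (pdom p) r) as Or.
  destruct (cartesian_compare Or Cr (pull_map_over sg) (@pull_map_cartesian _ sg))
    as (i & (j & IJ & JI) & Oi & Ei).
  assert (Oj : over (pdom p) j (idm (pdom p Z))).
  { apply (over_cancel_vertical Oi); rewrite JI; now apply over_id. }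
  assert (Ox : over (pdom p) (x ∘ j) (fmap (pdom p) x))
    by exact (over_vertical_comp Oj (over_fmap _ x)).
  destruct (lp_universal L (sigma := sg) Ox) as (t & (e & Et & Eh) & Ut).
  change (x ∘ j = lp_map L ∘ pull_comparison e) in Eh.
  exists (pull_comparison e ∘ i); split; [split|].
  - now rewrite comp_assoc, comparison_map.
  - now rewrite comp_assoc, <- Eh, <- comp_assoc, JI, comp_idr.
  - intros s' [H1 H2].
    destruct (over_between (q := pdom p) (s' ∘ j) (pull_base sg)
      (pull_base (lp_sigma L))) as (t' & Ot').
    assert (P' : pull_map c (lp_sigma L) ∘ (s' ∘ j) = pull_map c sg).
    { now rewrite comp_assoc, H1, <- Ei, <- comp_assoc, IJ, comp_idr. }
    assert (e' : lp_sigma L ∘ t' = sg).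
    { apply (over_unique (q := pdom p) (f := pull_map c (lp_sigma L) ∘ (s' ∘ j))).
      - exact (over_comp Ot' (pull_map_over _)).
      - rewrite P'; apply pull_map_over. }
    pose proof (comparison_unique e' Ot' P') as Es.
    assert (Ett : t = t').
    { apply Ut; exists e'; split.
      - apply (over_unique (q := pdom p) (f := lp_map L ∘ (s' ∘ j))).
        + exact (over_comp Ot' (lp_over L)).
        + now rewrite comp_assoc, H2.
      - change (x ∘ j = lp_map L ∘ pull_comparison e').
        now rewrite <- Es, comp_assoc, H2. }
    subst t'; rewrite (proof_irrelevance _ e e'), <- Es, <- comp_assoc, JI.
    apply comp_idr.
Qed.

End LiftingProblems.

(** * The comonad laws *)

Section StepOneLaws.
Variables (E B : Category) (p : Functor E B) (c : Cleavage p) (m : Vert p).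

Section Choice.
Variable S : step_one_choice c m.

Lemma lift_uniq (y g : Vert p) (s s' : Hom y (pull c (lp_sigma (so_lp S g)))) :
  cartesian (pdom p) (pull_map c (lp_sigma (so_lp S g)) ∘ s) ->
  pull_map c (lp_sigma (so_lp S g)) ∘ s = pull_map c (lp_sigma (so_lp S g)) ∘ s' ->
  lp_map (so_lp S g) ∘ s = lp_map (so_lp S g) ∘ s' -> s = s'.
Proof. exact (universal_span_uniq (span_of_lifting_problem (so_lp S g))). Qed.

Lemma induced_uniq (K : B) (sigma : Hom K (pdom p m)) (g : Vert p)
  (x : Hom (pull c sigma) g) (s s' : Hom (pull c sigma) (pull c (lp_sigma (so_lp S g)))) :
  induced x s -> induced x s' -> s = s'.
Proof.
  intros [H1 H2] [H1' H2']; apply lift_uniq.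
  - rewrite H1; apply pull_map_cartesian.
  - now rewrite H1.
  - now rewrite H2.
Qed.

Lemma induced_exists (K : B) (sigma : Hom K (pdom p m)) (g : Vert p)
  (x : Hom (pull c sigma) g) :
  exists s : Hom (pull c sigma) (pull c (lp_sigma (so_lp S g))), unique (induced x) s.
Proof.
  destruct (span_of_lifting_problem (so_lp S g)) as [_ U].
  exact (U _ _ x (@pull_map_cartesian _ _ _ c _ _ sigma)).
Qed.

Lemma left_uniq (f z : Vert p) (l l' : Hom (so_left S f) z) :
  sq_dom l = sq_dom l' -> l ∘ so_k S f = l' ∘ so_k S f -> l = l'.
Proof. exact (opcartesian_uniq (q := domF p) (@so_k_opcartesian _ _ _ _ _ S f) (h := l) (h' := l')). Qed.

Lemma so_k_dom (f : Vert p) : sq_dom (so_k S f) = sq_dom (lp_map (so_lp S f)).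
Proof.
  rewrite (so_eps_k S f); cbn; rewrite so_eps_dom; symmetry; apply comp_idl.
Qed.

(** Since [so_k] and [lp_map] have equal domain components, [Hd] says exactly that [d] is compatible
    with [so_k S g ∘ s], which therefore factors through the opcartesian [so_k S f]. *)
Lemma extends_exists (f g : Vert p) (d : Hom (dom f) (dom g))
  (x : Hom (pull c (lp_sigma (so_lp S f))) g) :
  d ∘ sq_dom (so_k S f) = sq_dom x ->
  exists l, unique (@extends _ _ _ c m S f g d x) l.
Proof.
  intros Hd; destruct (induced_exists x) as (s & Hs).
  destruct (proj1 (opcartesian_iff _ _) (@so_k_opcartesian _ _ _ _ _ S f) (so_left S g)
    (so_k S g ∘ s) d) as (l & (L1 & L2) & _).
  { refine (eq_trans Hd (eq_trans (eq_sym (f_equal (@sq_dom _ _ _ _ _) (proj2 (proj1 Hs)))) _)).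
    exact (f_equal (fun k => k ∘ sq_dom s) (eq_sym (so_k_dom g))). }
  exists l; split.
  - split; [exact L1 | now exists s].
  - intros l' [L1' (s' & Hs' & L2')]; apply left_uniq; [exact (eq_trans L1 (eq_sym L1'))|].
    refine (eq_trans L2 (eq_trans _ (eq_sym L2'))).
    now rewrite (induced_uniq (proj1 Hs) (proj1 Hs')).
Qed.

End Choice.

Lemma step_one_exists (S : step_one_choice c m) : inhabited (step_one c m).
Proof.
  assert (Hm : forall f g (a : Hom f g), exists l,
    unique (@extends _ _ _ c m S f g (sq_dom a) (a ∘ lp_map (so_lp S f))) l).
  { intros f g a; apply extends_exists.
    exact (f_equal (fun k => sq_dom a ∘ k) (so_k_dom S f)). }
  assert (Hs : forall f, exists l, unique (@extends _ _ _ c m S f (left_ob (so_fac S) f)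
    (idm (dom f)) (so_k S f)) l).
  { intros f; apply extends_exists; apply comp_idl. }
  pose (M f g a := constructive_indefinite_description _ (Hm f g a)).
  pose (Sg f := constructive_indefinite_description _ (Hs f)).
  exact (inhabits {| so_choice := S;
    so_map := fun f g a => proj1_sig (M f g a);
    so_map_spec := fun f g a => proj2_sig (M f g a);
    so_comult := fun f => proj1_sig (Sg f);
    so_comult_spec := fun f => proj2_sig (Sg f) |}).
Qed.

Variable S : step_one c m.

Notation Lo := (left_ob (so_fac S)).

(** Only the type differs from [so_k]: [so_left] and [left_ob (so_fac S)] are convertible, and
    rewriting needs one syntactic form of the target. *)
Definition opk (f : Vert p) : Hom (pull c (lp_sigma (so_lp S f))) (Lo f) := so_k S f.

Lemma sq_dom_comp (f g h : Vert p) (b : Hom g h) (a : Hom f g) :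
  sq_dom (b ∘ a) = sq_dom b ∘ sq_dom a.
Proof. reflexivity. Qed.

Lemma counit_eps (f : Vert p) : counit (so_fac S) f = so_eps S f.
Proof. apply square_eq; [symmetry; apply so_eps_dom | reflexivity]. Qed.

Lemma counit_opk (f : Vert p) : counit (so_fac S) f ∘ opk f = lp_map (so_lp S f).
Proof. rewrite counit_eps; symmetry; apply so_eps_k. Qed.

Lemma opk_uniq (f z : Vert p) (l l' : Hom (Lo f) z) :
  sq_dom l = sq_dom l' -> l ∘ opk f = l' ∘ opk f -> l = l'.
Proof. exact (@left_uniq S f z l l'). Qed.

Lemma so_map_dom (f g : Vert p) (a : Hom f g) : sq_dom (so_map S a) = sq_dom a.
Proof. exact (proj1 (proj1 (so_map_spec S a))). Qed.

Lemma so_map_k (f g : Vert p) (a : Hom f g) :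
  exists s, @induced _ _ _ c m S _ (lp_sigma (so_lp S f)) g (a ∘ lp_map (so_lp S f)) s /\
    so_map S a ∘ opk f = opk g ∘ s.
Proof.
  destruct (proj2 (proj1 (so_map_spec S a))) as (s & [Hs _] & H); now exists s.
Qed.

Lemma so_comult_dom (f : Vert p) : sq_dom (so_comult S f) = idm (dom f).
Proof. exact (proj1 (proj1 (so_comult_spec S f))). Qed.

Lemma so_comult_k (f : Vert p) :
  exists s, @induced _ _ _ c m S _ (lp_sigma (so_lp S f)) (Lo f) (opk f) s /\
    so_comult S f ∘ opk f = opk (Lo f) ∘ s.
Proof.
  destruct (proj2 (proj1 (so_comult_spec S f))) as (s & [Hs _] & H); now exists s.
Qed.

Lemma so_counit_natural (f g : Vert p) (a : Hom f g) :
  counit (so_fac S) g ∘ so_map S a = a ∘ counit (so_fac S) f.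
Proof.
  destruct (so_map_k a) as (s & [S1 S2] & H).
  apply opk_uniq.
  - rewrite !sq_dom_comp, so_map_dom; exact (eq_trans (comp_idl _) (eq_sym (comp_idr _))).
  - rewrite <- !comp_assoc, H, comp_assoc, !counit_opk; exact S2.
Qed.

Lemma so_map_id (f : Vert p) : so_map S (idm f) = idm (Lo f).
Proof.
  destruct (so_map_k (idm f)) as (s & Hs & H).
  apply opk_uniq; [exact (so_map_dom (idm f))|].
  rewrite H, (induced_uniq (s := s) (s' := idm _) Hs).
  - now rewrite comp_idr, comp_idl.
  - split; [apply comp_idr | now rewrite comp_idl, comp_idr].
Qed.

Lemma so_map_comp (f g h : Vert p) (b : Hom g h) (a : Hom f g) :
  so_map S (b ∘ a) = so_map S b ∘ so_map S a.
Proof.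
  destruct (so_map_k a) as (s & [S1 S2] & H).
  destruct (so_map_k b) as (s' & [S1' S2'] & H').
  destruct (so_map_k (b ∘ a)) as (s'' & Hs & H'').
  apply opk_uniq; [now rewrite sq_dom_comp, !so_map_dom|].
  rewrite H'', (induced_uniq (s := s'') (s' := s' ∘ s) Hs).
  - now rewrite <- comp_assoc, H, !comp_assoc, H'.
  - split; rewrite comp_assoc.
    + now rewrite S1'.
    + now rewrite S2', <- comp_assoc, S2, comp_assoc.
Qed.

Lemma so_functorial : functorial_factorisation (so_Kmap S).
Proof.
  split.
  - intros f g a; rewrite <- so_map_dom; exact (sq_comm (so_map S a)).
  - intros f g a; exact (f_equal (@sq_cod _ _ _ _ _) (so_counit_natural a)).
  - intros f; exact (f_equal (@sq_cod _ _ _ _ _) (so_map_id f)).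
  - intros f g h b a; exact (f_equal (@sq_cod _ _ _ _ _) (so_map_comp b a)).
Qed.

(** The left side has [sq_dom a] as its domain component by construction, the right side by a proved
    equation. This reduces the laws to statements about [so_map], for every proof [H] of
    functoriality. *)
Lemma left_functor_map (H : functorial_factorisation (so_Kmap S)) (f g : Vert p)
  (a : Hom f g) : fmap (left_functor H) a = so_map S a.
Proof. apply square_eq; [exact (eq_sym (so_map_dom a)) | reflexivity]. Qed.

Lemma comult_counit_left (f : Vert p) :
  counit (so_fac S) (Lo f) ∘ so_comult S f = idm (Lo f).
Proof.
  destruct (so_comult_k f) as (s & [S1 S2] & H).
  apply opk_uniq.
  - rewrite sq_dom_comp, so_comult_dom; apply comp_idl.
  - now rewrite <- comp_assoc, H, comp_assoc, counit_opk, S2, comp_idl.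
Qed.

Lemma comult_counit_right (f : Vert p) :
  so_map S (counit (so_fac S) f) ∘ so_comult S f = idm (Lo f).
Proof.
  destruct (so_comult_k f) as (s & [S1 S2] & H).
  destruct (so_map_k (counit (so_fac S) f)) as (s' & [S1' S2'] & H').
  apply opk_uniq.
  - rewrite sq_dom_comp, so_map_dom, so_comult_dom; apply comp_idl.
  - rewrite <- comp_assoc, H, comp_assoc, H', <- comp_assoc, comp_idl.
    (* [s' ∘ s] is an endomorphism of the universal lifting problem that respects both legs, hence
       an identity. *)
    rewrite (lift_uniq (s := s' ∘ s) (s' := idm _)); [apply comp_idr|..].
    + rewrite comp_assoc, S1', S1; apply pull_map_cartesian.
    + now rewrite comp_assoc, S1', S1, comp_idr.
    + now rewrite comp_assoc, S2', <- comp_assoc, S2, counit_opk, comp_idr.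
Qed.

Lemma comult_natural (f g : Vert p) (a : Hom f g) :
  so_comult S g ∘ so_map S a = so_map S (so_map S a) ∘ so_comult S f.
Proof.
  destruct (so_comult_k f) as (sf & [F1 F2] & Hf).
  destruct (so_comult_k g) as (sg & [G1 G2] & Hg).
  destruct (so_map_k a) as (s & [S1 S2] & H).
  destruct (so_map_k (so_map S a)) as (s' & [S1' S2'] & H').
  apply opk_uniq.
  - rewrite !sq_dom_comp, !so_comult_dom, !so_map_dom.
    exact (eq_trans (comp_idl _) (eq_sym (comp_idr _))).
  - rewrite <- !comp_assoc, H, Hf, !comp_assoc, Hg, H', <- !comp_assoc.
    f_equal; apply lift_uniq.
    + rewrite comp_assoc, G1, S1; apply pull_map_cartesian.
    + now rewrite !comp_assoc, G1, S1', S1, F1.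
    + now rewrite !comp_assoc, G2, S2', <- comp_assoc, F2, <- H.
Qed.

Lemma comult_coassociative (f : Vert p) :
  so_comult S (Lo f) ∘ so_comult S f = so_map S (so_comult S f) ∘ so_comult S f.
Proof.
  destruct (so_comult_k f) as (sf & [F1 F2] & Hf).
  destruct (so_comult_k (Lo f)) as (sg & [G1 G2] & Hg).
  destruct (so_map_k (so_comult S f)) as (s' & [S1' S2'] & H').
  apply opk_uniq.
  - now rewrite !sq_dom_comp, so_map_dom, !so_comult_dom.
  - rewrite <- !comp_assoc, Hf, !comp_assoc, Hg, H', <- !comp_assoc.
    f_equal; apply lift_uniq.
    + rewrite comp_assoc, G1, F1; apply pull_map_cartesian.
    + now rewrite !comp_assoc, G1, S1', F1.
    + now rewrite !comp_assoc, G2, S2', <- comp_assoc, F2, <- Hf.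
Qed.

Lemma step_one_lawfs : is_lawfs (so_Kmap S) (so_comult S).
Proof.
  exists so_functorial; split; [exact so_comult_dom|].
  split.
  - intros f g a; rewrite left_functor_map; apply so_counit_natural.
  - intros f g a; rewrite !left_functor_map; apply comult_natural.
  - exact comult_counit_left.
  - intros f; rewrite left_functor_map; apply comult_counit_right.
  - intros f; rewrite left_functor_map; apply comult_coassociative.
Qed.

End StepOneLaws.

(** * Existence and fibredness *)

(** An arrow [x] into [q V] is realised by a cartesian [xt] into [V]. The problem [e' ∘ xt] then
    factors through the cartesian [a] over [y], and the factor is a problem for [X], classified by a
    map to [U]. *)
Lemma universal_span_pullback (D B : Category) (q : Functor D B) (A X Y U V : D)
  (al : Hom U A) (e : Hom U X) (al' : Hom V A) (e' : Hom V Y) (a : Hom X Y)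
  (s : Hom U V) :
  is_fibration q -> universal_span q al e -> universal_span q al' e' ->
  cartesian q a -> al' ∘ s = al -> e' ∘ s = a ∘ e ->
  is_pullback (fmap q s) (fmap q e) (fmap q e') (fmap q a).
Proof.
  intros Hq HU HV Ca H1 H2; pose proof HU as [Cal XU]; pose proof HV as [Cal' XV].
  assert (Cs : cartesian q s) by (apply (cartesian_cancel Cal'); now rewrite H1).
  split; [now rewrite <- !fmap_comp, H2|]; intros Z x y Hxy.
  destruct (Hq V Z x) as (T & xt & Ox & Cx).
  pose proof (over_src Ox) as eT; destruct eT; apply hom_eq_eq in Ox; subst x.
  destruct (Ca T (e' ∘ xt) y) as (h & (Ph & Eh) & _).
  { now rewrite fmap_comp. }
  destruct (XU T (al' ∘ xt) h) as (t & [T1 T2] & Ut).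
  { now apply cartesian_comp. }
  exists (fmap q t); split; [split|].
  - rewrite <- fmap_comp; f_equal; apply (universal_span_uniq HV).
    + rewrite comp_assoc, H1, T1; now apply cartesian_comp.
    + now rewrite comp_assoc, H1, T1.
    + now rewrite comp_assoc, H2, <- comp_assoc, T2, Eh.
  - now rewrite <- fmap_comp, T2.
  - intros w [W1 W2]; destruct (Cs T xt w W1) as (t' & (P' & E') & _).
    rewrite <- P'; f_equal; apply Ut; split.
    + now rewrite <- H1, <- comp_assoc, E'.
    + apply (cartesian_uniq Ca).
      * now rewrite fmap_comp, P', Ph.
      * now rewrite Eh, comp_assoc, <- H2, <- comp_assoc, E'.
Qed.

(** * Existence of step-one *)

Section Existence.
Variables (E B : Category) (p : Functor E B) (c : Cleavage p) (m : Vert p).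

(** The part of [step_one_choice] beyond the lifting problem, at a single [f]; existence is proved
    pointwise and a choice for all [f] is made afterwards. *)
Record left_factorisation (f : Vert p) (L : universal_lifting_problem c m f) := {
  lf_K : E;
  lf_L : Hom (dom f) lf_K;
  lf_vertical : vertical p lf_L;
  lf_left := {| dom := dom f; cod := lf_K; arr := lf_L; arr_vertical := lf_vertical |}
    : Vert p;
  lf_k : Hom (pull c (lp_sigma L)) lf_left;
  lf_k_opcartesian : opcartesian (domF p) lf_k;
  lf_eps : Hom lf_left f;
  lf_eps_dom : sq_dom lf_eps = idm (dom f);
  lf_eps_k : lp_map L = lf_eps ∘ lf_k
}.

Lemma left_factorisation_exists (f : Vert p) (L : universal_lifting_problem c m f) :
  is_fibration (fop p) -> (forall I : B, has_pushouts (Fibre p I)) ->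
  inhabited (left_factorisation L).
Proof.
  intros Hop Hpo.
  destruct (opcartesian_dom_exists c Hop (sq_dom (lp_map L)) Hpo) as (K & l & n & Vl & P).
  pose proof P as [Hc U].
  pose (z := {| dom := dom f; cod := K; arr := l; arr_vertical := Vl |} : Vert p).
  pose (k := @Build_square _ _ p (pull c (lp_sigma L)) z (sq_dom (lp_map L)) n
    (eq_sym Hc)).
  destruct (U _ (sq_cod (lp_map L)) (arr f)) as (t & [T1 T2] & _).
  { symmetry; apply sq_comm. }
  pose (eps := @Build_square _ _ p z f (idm (dom f)) t
    (eq_trans (comp_idr _) (eq_sym T2))).
  refine (inhabits (@Build_left_factorisation f L K l Vl k _ eps eq_refl _)).
  - apply opcartesian_dom_pushout; exact P.
  - apply square_eq; cbn; [now rewrite comp_idl | now symmetry].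
Qed.

Definition inhabitant (T : Type) (H : inhabited T) : T :=
  proj1_sig (constructive_indefinite_description (fun _ : T => True)
    (let 'inhabits x := H in ex_intro _ x I)).

Lemma step_one_choice_exists :
  is_fibration (fop p) -> (forall I : B, has_pushouts (Fibre p I)) ->
  locally_small c -> has_finite_limits B -> inhabited (step_one_choice c m).
Proof.
  intros Hop Hpo Hls Hlim.
  assert (HL : forall f, inhabited (universal_lifting_problem c m f)).
  { intros f; destruct (universal_span_vert Hlim m f Hls) as (U & al & e & HU).
    exact (lifting_problem_of_span c HU). }
  pose (L f := inhabitant (HL f)).
  pose (F f := inhabitant (left_factorisation_exists (L f) Hop Hpo)).
  exact (inhabits {| so_lp := L; so_K := fun f => lf_K (F f);
    so_L := fun f => lf_L (F f); so_L_vertical := fun f => lf_vertical (F f);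
    so_k := fun f => lf_k (F f);
    so_k_opcartesian := fun f => @lf_k_opcartesian _ _ (F f);
    so_eps := fun f => lf_eps (F f); so_eps_dom := fun f => lf_eps_dom (F f);
    so_eps_k := fun f => lf_eps_k (F f) |}).
Qed.

End Existence.

(** * Fibredness of step-one *)

Section Fibredness.
Variables (E B : Category) (p : Functor E B) (c : Cleavage p).

Lemma vert_fibration : is_fibration (pdom p).
Proof.
  intros y I u; destruct (vert_lift c u) as (x & a & _ & Oa & Ca & _); now exists x, a.
Qed.

(* Pushing out along dom commutes with reindexing: decompose both pushouts as an
   opcartesian pushforward followed by a pushout in a fibre; Beck-Chevalley handles the
   first and fibred pushouts the second. *)
Lemma pushout_cartesian (M M' l l' : Vert p) (s : Hom M M') (a : Hom l l')
  (k : Hom M l) (k' : Hom M' l') :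
  is_fibration (fop p) -> beck_chevalley p -> has_fibred_pushouts c ->
  is_pushout (arr M) (sq_dom k) (sq_cod k) (arr l) ->
  is_pushout (arr M') (sq_dom k') (sq_cod k') (arr l') ->
  k' ∘ s = a ∘ k ->
  cartesian p (sq_dom s) -> cartesian p (sq_cod s) -> cartesian p (sq_dom a) ->
  is_pullback (fmap p (sq_dom s)) (fmap p (sq_dom k))
    (fmap p (sq_dom k')) (fmap p (sq_dom a)) ->
  cartesian p (sq_cod a).
Proof.
  intros Hop Hbc [_ Hpres] P P' Hsq Cs1 Cs2 Ca PB.
  pose proof (f_equal (@sq_cod _ _ _ _ _) Hsq) as Hk; cbn in Hk.
  pose (tau' := fmap p (sq_dom k')); pose (tau := fmap p (sq_dom k)).
  pose (u := fmap p (sq_dom a)); pose (t := fmap p (sq_dom s)).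
  assert (Htu : tau' ∘ t = u ∘ tau) by exact (proj1 PB).
  destruct (pushforward_factorisation Hop (arr_over M') (over_fmap p (sq_dom k')))
    as (A' & C' & k1' & k2' & m' & v' & O1' & O2' & Ok1' & Ok2' & Om' & Ov' & Ev' & Q').
  pose proof P' as [Hc' U'].
  pose proof Q' as [Hq' UQ'].
  destruct (UQ' _ (sq_cod k') (arr l' ∘ v')) as (n' & [N1 N2] & _).
  { now rewrite Hc', <- comp_assoc, Ev'. }
  assert (On' : over p n' (idm (p (dom l')))).
  { apply (over_cancel_vertical Om'); rewrite N2.
    exact (over_comp_vertical Ov' (arr_over l')). }
  (* With the pushforward square cancelled, all four sides are vertical over the base of [dom l'],
     so reindexing along [u] preserves this pushout. *)
  assert (R' : is_pushout m' v' n' (arr l')).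
  { apply (pushout_cancel Q' N2); rewrite Ev', N1; exact P'. }
  (* [A], [C] and [K] are the reindexings along [u] of [A'], [C'] and [cod l']; [dom l] already
     reindexes [dom l'] because [sq_dom a] is cartesian. The aim is to identify [K] with [cod l]. *)
  destruct (cartesian_lift c u (over_src_id Om')) as (A & ga & Oga & Cga & OA).
  destruct (cartesian_lift c u (over_src_id On')) as (C & gc & Ogc & Cgc & OC).
  destruct (cartesian_lift c u (over_tgt_id On')) as (K & gk & Ogk & Cgk & OK).
  assert (Oa : over p (sq_dom a) u) by constructor.
  assert (lift : forall Z Y X (g : Hom Y X) (f0 : Hom Z X) I (w : Hom I _),
    over p g u -> cartesian p g -> over p f0 (u ∘ w) ->
    exists h : Hom Z Y, over p h w /\ g ∘ h = f0).
  { intros Z Y X g0 f0 I w Og Cg Of.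
    destruct (cartesian_over Og Cg Of) as (h & Hh & _); now exists h. }
  destruct (lift _ _ _ (sq_dom a) (v' ∘ ga) _ (idm _) Oa Ca) as (v & Ov & Ev).
  { rewrite comp_idr; exact (over_comp_vertical Oga Ov'). }
  destruct (lift _ _ _ gc (m' ∘ ga) _ (idm _) Ogc Cgc) as (m & Om & Em).
  { rewrite comp_idr; exact (over_comp_vertical Oga Om'). }
  destruct (lift _ _ _ gk (n' ∘ gc) _ (idm _) Ogk Cgk) as (n & On & En).
  { rewrite comp_idr; exact (over_comp_vertical Ogc On'). }
  destruct (lift _ _ _ gk (arr l' ∘ sq_dom a) _ (idm _) Ogk Cgk) as (j & Oj & Ej).
  { rewrite comp_idr; exact (over_comp_vertical Oa (arr_over l')). }
  destruct (lift _ _ _ ga (k1' ∘ sq_dom s) _ tau Oga Cga) as (k1 & Ok1 & Ek1).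
  { rewrite <- Htu; exact (over_comp (over_fmap p (sq_dom s)) Ok1'). }
  destruct (lift _ _ _ gc (k2' ∘ sq_cod s) _ tau Ogc Cgc) as (k2 & Ok2 & Ek2).
  { rewrite <- Htu; refine (over_comp _ Ok2').
    exact (square_cod_over (over_fmap (pdom p) s)). }
  assert (R : is_pushout m v n j).
  { refine (cartesian_pushout (Hpres _ _ u) R' Om' Ov' On' (arr_over l') Om Ov On Oj
      Oga Ogc Oa Ogk Cga Cgc Ca Cgk _ _ _ _); assumption. }
  assert (Evk : v ∘ k1 = sq_dom k).
  { apply (cartesian_uniq_over Ca (w := tau)).
    - exact (over_comp_vertical Ok1 Ov).
    - constructor.
    - rewrite comp_assoc, Ev, <- comp_assoc, Ek1, comp_assoc, Ev'.
      exact (f_equal (@sq_dom _ _ _ _ _) Hsq). }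
  assert (Emk : k2 ∘ arr M = m ∘ k1).
  { apply (cartesian_uniq_over Cgc (w := tau)).
    - exact (over_vertical_comp (arr_over M) Ok2).
    - exact (over_comp_vertical Ok1 Om).
    - rewrite !comp_assoc, Ek2, Em, <- !comp_assoc, Ek1, <- sq_comm, !comp_assoc.
      now rewrite Hq'. }
  (* The base squares of the two pushforwards differ from [PB] only by images of vertical maps,
     which are invertible. *)
  assert (PB1 : is_pullback (fmap p (sq_dom s)) (fmap p k1) (fmap p k1') (fmap p ga)).
  { refine (pullback_iso_inv (x := idm _) (y := idm _) (v := fmap p v) (w := fmap p v')
      PB (iso_id _) (iso_id _) (over_idm_iso Ov) (over_idm_iso Ov') _ _ _ _).
    - now rewrite comp_idl, comp_idr.
    - now rewrite comp_idr, <- fmap_comp, Evk.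
    - now rewrite comp_idr, <- fmap_comp, Ev'.
    - now rewrite <- !fmap_comp, Ev. }
  assert (PB2 : is_pullback (fmap p (sq_cod s)) (fmap p k2) (fmap p k2') (fmap p gc)).
  { refine (pullback_iso (x := fmap p (arr M)) (y := fmap p (arr M')) (v := fmap p m)
      (w := fmap p m') PB1 _ _ _ _ _ _ _ _);
      try (eapply over_idm_iso; first [eassumption | apply arr_over]);
      rewrite <- !fmap_comp; f_equal.
    - symmetry; apply sq_comm.
    - exact Emk.
    - exact Hq'.
    - exact Em. }
  (* Beck-Chevalley from cartesian to opcartesian: [ga] is cartesian, [k1'] opcartesian, and the
     remaining side [sq_dom s] is cartesian. *)
  assert (O1 : opcartesian p k1).
  { apply (proj2 (Hbc _ _ _ _ (sq_dom s) k1 ga k1' Ek1 PB1 Cga O1')); exact Cs1. }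
  assert (O2 : opcartesian p k2).
  { apply (proj2 (Hbc _ _ _ _ (sq_cod s) k2 gc k2' Ek2 PB2 Cgc O2')); exact Cs2. }
  pose proof (pushforward_pushout (arr_vertical M) (over_idm_vertical Om) O1 O2 Emk) as Q.
  pose proof (pushout_paste Q R) as PK; rewrite Evk in PK.
  (* [cod l] and [K] are pushouts of the same span, so [sq_cod a] is the cartesian [gk] preceded by
     an isomorphism. *)
  destruct (pushout_unique_iso P PK) as (th & Ith & T1 & T2).
  assert (Ea : gk ∘ th = sq_cod a).
  { apply (pushout_uniq P); rewrite <- comp_assoc.
    - rewrite T1, comp_assoc, En, <- comp_assoc, Ek2, comp_assoc, N1; exact Hk.
    - rewrite T2, Ej; apply sq_comm. }
  rewrite <- Ea; apply cartesian_comp; [now apply iso_cartesian | exact Cgk].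
Qed.

Variable m : Vert p.

(** The induced [s] is a map between reindexings of [m] over [m], hence cartesian by cancellation.
    Cartesianness of [a] enters through the domain component and through the pullback of the objects
    Hom(m, f) and Hom(m, g). *)
Lemma step_one_fibred (S : step_one c m) (H : functorial_factorisation (so_Kmap S)) :
  is_fibration (fop p) -> beck_chevalley p -> has_fibred_pushouts c ->
  preserves_cartesian (pdom p) (pdom p) (left_functor H).
Proof.
  intros Hop Hbc Hpo f g a Ca; rewrite left_functor_map.
  pose proof (proj1 (cartesian_levels c a) Ca) as [Ca1 Ca2].
  destruct (so_map_k S a) as (s & [S1 S2] & Hs).
  assert (Cd : cartesian p (sq_dom (so_map S a))) by (rewrite so_map_dom; exact Ca1).
  apply (cartesian_levels c); split; [exact Cd|].
  assert (Cs : cartesian (pdom p) s).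
  { apply (cartesian_cancel (@pull_map_cartesian _ _ _ c _ _ (lp_sigma (so_lp S g)))).
    rewrite S1; apply pull_map_cartesian. }
  apply (cartesian_levels c) in Cs; destruct Cs as [Cs1 Cs2].
  assert (PB : is_pullback (fmap p (sq_dom s)) (fmap p (sq_dom (so_k S f)))
    (fmap p (sq_dom (so_k S g))) (fmap p (sq_dom (so_map S a)))).
  { rewrite so_map_dom, !so_k_dom.
    exact (universal_span_pullback vert_fibration
      (span_of_lifting_problem (so_lp S f)) (span_of_lifting_problem (so_lp S g))
      Ca S1 S2). }
  refine (pushout_cartesian (s := s) (k := opk S f) (k' := opk S g) Hop Hbc Hpo
    _ _ (eq_sym Hs) Cs1 Cs2 Cd PB);
    apply opcartesian_dom_pushout; apply so_k_opcartesian.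
Qed.

End Fibredness.

(** The first conjunct ensures that the quantification over all choices of step-one is not
    vacuous. *)
Theorem theorem4p6p4 (E B : Category) (p : Functor E B) (c : Cleavage p)
  (Hbi : is_bifibration p)
  (Hls : locally_small c)
  (Hbc : beck_chevalley p)
  (Hpo : has_fibred_pushouts c)
  (Hlim : has_finite_limits B)
  (m : Vert p) :
  inhabited (step_one c m) /\
  forall S : step_one c m, is_fibred_lawfs (so_Kmap S) (so_comult S).
Proof.
  destruct Hbi as [_ Hop]; split.
  - destruct (step_one_choice_exists m Hop (proj1 Hpo) Hls Hlim) as [S].
    exact (step_one_exists S).
  - intros S; split; [apply step_one_lawfs|]; intros H; now apply step_one_fibred.
Qed.
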